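(* Let $F:\mathbb R^d\to\mathbb R$ be bounded below by $F_*$, $L$-smooth and twice differentiable, with stochastic gradients satisfying the $p$-bounded central moment condition with constant $\sigma$ and stochastic Hessians satisfying the $p$-bounded central moment condition with constant $\sigma_h$, where $p\in(1,2]$. Let $\Delta_1:=F(x_0)-F_*$. Let $\delta\in(0,1]$ and $T\ge1$ be such that $\log(8T/\delta)\ge1$. Suppose the algorithm Clip NSGDHess is executed with momentum parameter $\alpha=T^{-\frac p{2p-1}}$, clipping levels $$\lambda=\max\Big\{4\sqrt{L\Delta_1},\frac{\sigma}{\alpha^{1/p}}\Big\},\qquad \lambda_h=\frac{2\gamma(L+\sigma_h)}{\alpha^{1/p}},$$ and stepsize $\gamma>0$ satisfying $$\gamma\le\mathcal O\Big(\min\Big\{\sqrt{\frac{\Delta_1}{LT}},\ \alpha\sqrt{\frac{\Delta_1}{L}},\ \frac{\sqrt{\Delta_1/L}}{\alpha T\log(T/\delta)},\ \frac{\Delta_1}{\sigma\alpha^{\frac{p-1}p}T\log(T/\delta)},\ \sqrt{\frac{\Delta_1\alpha^{1/p}}{(L+\sigma_h)T\log(T/\delta)}}\Big\}\Big)$$ (i.e. $\gamma\le c\,\min\{\cdots\}$ for a suitable universal constant $c>0$). Then, with probability at least $1-\delta$, $$\frac1T\sum_{t=0}^{T-1}\|\nabla F(x_t)\|\le\frac{2\Delta_1}{\gamma T}.$$ As a result (when $\gamma$ is taken equal to this upper bound), with probability at least $1-\delta$, $$\frac1T\sum_{t=0}^{T-1}\|\nabla F(x_t)\|=\mathcal O\Big(\frac{\sqrt{\Delta_1(L+\sigma_h)}+\sigma}{T^{\frac{p-1}{2p-1}}}\log\Big(\frac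 T\delta\Big)\Big).$$
   Context: **Problem.** Minimize $F(x)=\mathbb E_{\xi\sim\mathcal D}[f(x,\xi)]$ over $x\in\mathbb R^d$. **Assumptions.** (Lower boundedness) $F\ge F_*>-\infty$. ($L$-smoothness) $F$ is differentiable and $\|\nabla F(x)-\nabla F(y)\|\le L\|x-y\|$ for all $x,y$. ($p$-BCM for gradients) stochastic gradients $\nabla f(x,\xi)$ are available with $\mathbb E[\nabla f(x,\xi)]=\nabla F(x)$ and $\mathbb E[\|\nabla f(x,\xi)-\nabla F(x)\|^p]\le\sigma^p$ for all $x$, $\sigma>0$. ($p$-BCM for Hessians) $F$ is twice differentiable and stochastic Hessian-vector products $\nabla^2f(x,\xi)\cdot v$ are available for every $v\in\mathbb R^d$, with $\mathbb E[\nabla^2f(x,\xi)]=\nabla^2F(x)$ and $\mathbb E[\|\nabla^2f(x,\xi)-\nabla^2F(x)\|_{\mathrm{op}}^p]\le\sigma_h^p$ for all $x$, $\sigma_h>0$. **Clipping.** $\mathtt{clip}(v,\lambda)=\min\{1,\lambda/\|v\|\}\,v$ for $v\ne0$, and $\mathtt{clip}(0,\lambda)=0$. **Algorithm Clip NSGDHess.** Input: $x_0\in\mathbb R^d$, stepsize $\gamma>0$, momentum parameter $\alpha>0$, clipping levels $\lambda>0$ and $\bar\lambda_h>0$, number of iterations $T$; write $\lambda_h=\gamma\bar\lambda_h$. Set $x_1=x_0$, $g_0=0$. For $t=1,\dots,T-1$: sample $q_t$ uniformly on $[0,1]$; set $\hat x_t=q_tx_t+(1-q_t)x_{t-1}$;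 sample $\xi_t,\hat\xi_t\sim\mathcal D$ independently (all samples $q_t,\xi_t,\hat\xi_t$ are independent of each other and of the past); set $$g_t=(1-\alpha)\big(g_{t-1}+\mathtt{clip}(\nabla^2f(\hat x_t,\hat\xi_t)(x_t-x_{t-1}),\lambda_h)\big)+\alpha\,\mathtt{clip}(\nabla f(x_t,\xi_t),\lambda),\qquad x_{t+1}=x_t-\gamma\frac{g_t}{\|g_t\|}.$$ (Equivalently the Hessian term is $\gamma\,\mathtt{clip}(\gamma^{-1}\nabla^2f(\hat x_t,\hat\xi_t)(x_t-x_{t-1}),\bar\lambda_h)$.) The convention $g/\|g\|=0$ for $g=0$ is used. $\mathcal O(\cdot)$ hides universal multiplicative constants.
   Formalization: The final O-bound is proved only when T/δ ≥ 2 (all T ≥ 2, or T = 1 with δ ≤ 1/2), since for T = 1 and δ close to 1 the factor log(T/δ) tends to 0 and the bound fails for any universal constant. *)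

(* Defs.v *)
From HB Require Import structures.
From mathcomp Require Import all_boot all_order all_algebra finmap.
From mathcomp Require Import all_classical all_reals all_analysis.

Set Implicit Arguments.
Unset Strict Implicit.
Unset Printing Implicit Defensive.

Import Order.TTheory GRing.Theory Num.Theory.
Import numFieldNormedType.Exports.

Local Open Scope classical_set_scope.
Local Open Scope ring_scope.

Section euclidean.
Context {R : realType} {d : nat}.
Implicit Types (v : 'rV[R]_d) (g : 'rV[R]_d -> R).

(* The library norm on matrices is the max norm. *)
Definition l2norm v : R := Num.sqrt (\sum_i v 0 i ^+ 2).

Definition opnorm (A : 'M[R]_d) : R :=
  sup [set l2norm (v *m A) | v in [set v | l2norm v <= 1]].

Definition grad g (x : 'rV[R]_d) : 'rV[R]_d :=
  \row_i 'D_(delta_mx 0 i) g x.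

(* Vectors are rows, so the Hessian-vector product is [v *m hess g x], the
   derivative of [grad g] at [x] in the direction [v]. *)
Definition hess g (x : 'rV[R]_d) : 'M[R]_d := 'J (grad g) x.

Definition twice_differentiable_at g (x : 'rV[R]_d) : Prop :=
  (\forall y \near x, differentiable g y) /\ differentiable (grad g) x.

Definition smooth (L : R) g : Prop :=
  (forall x, differentiable g x) /\
  forall x y, l2norm (grad g x - grad g y) <= L * l2norm (x - y).

Definition clip v (lambda : R) : 'rV[R]_d :=
  if v == 0 then 0 else Num.min 1 (lambda / l2norm v) *: v.

(* [normalize 0 = 0] *)
Definition normalize v : 'rV[R]_d := (l2norm v)^-1 *: v.

End euclidean.

(* R^d with its Borel sigma-algebra *)
Notation borelRV R d := (g_sigma_algebraType (@open 'rV[R]_d)).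

Section oracle.
Context {R : realType} {d : nat} {dX : measure_display}.
Context {Xi : measurableType dX}.
Variables (D : probability Xi R) (f : 'rV[R]_d -> Xi -> R).

(* Regularity making the expectations and the iterates of the algorithm
   well-defined: at each point the sampled objective is almost surely twice
   differentiable, and its two derivatives are jointly measurable. *)
Definition oracle_regular : Prop :=
  [/\ forall x, {ae D, forall xi, twice_differentiable_at (f^~ xi) x},
      forall i, measurable_fun setT
        (fun z : borelRV R d * Xi => grad (f^~ z.2) z.1 0 i) &
      forall i j, measurable_fun setT
        (fun z : borelRV R d * Xi => hess (f^~ z.2) z.1 i j)].

Definition objective (F : 'rV[R]_d -> R) : Prop :=
  forall x, D.-integrable setT (EFin \o f x) /\
    ('E_D[f x] = (F x)%:E)%E.

Definition bcm_grad (F : 'rV[R]_d -> R) (p sigma : R) : Prop :=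
  forall x,
    (forall i, ('E_D[fun xi => (grad (f^~ xi) x 0 i)%R] = (grad F x 0 i)%:E)%E) /\
    ('E_D[fun xi => (l2norm (grad (f^~ xi) x - grad F x) `^ p)%R]
       <= (sigma `^ p)%:E)%E.

Definition bcm_hess (F : 'rV[R]_d -> R) (p sigma_h : R) : Prop :=
  forall x,
    (forall i j, ('E_D[fun xi => (hess (f^~ xi) x i j)%R] = (hess F x i j)%:E)%E) /\
    ('E_D[fun xi => (opnorm (hess (f^~ xi) x - hess F x) `^ p)%R]
       <= (sigma_h `^ p)%:E)%E.

End oracle.

Section sampling.
Context {R : realType} {dO dX : measure_display}.
Context {Omega : measurableType dO} {Xi : measurableType dX}.
Variable P : probability Omega R.

Definition mutual_independence (I : choiceType) (A : set I)
    (S : I -> set_system Omega) : Prop :=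
  forall (J : {fset I}) (E : I -> set Omega), [set` J] `<=` A ->
    (forall j, j \in J -> S j (E j)) ->
    (P (\big[setI/setT]_(j <- J) E j) = \prod_(j <- J) P (E j))%E.

Definition sigma_of d' (X' : measurableType d') (Y : Omega -> X') :
  set_system Omega := preimage_set_system setT Y measurable.

(* The three summands index the samples q_t, xi_t and xihat_t. *)
Definition sample_sigma (q : nat -> Omega -> R) (xi xihat : nat -> Omega -> Xi)
    (s : nat + nat + nat) : set_system Omega :=
  match s with
  | inl (inl t) => sigma_of (q t)
  | inl (inr t) => sigma_of (xi t)
  | inr t => sigma_of (xihat t)
  end.

Definition sample_step (s : nat + nat + nat) : nat :=
  match s with inl (inl t) => t | inl (inr t) => t | inr t => t end.

Definition sampling (D : probability Xi R) (T : nat)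
    (q : nat -> {RV P >-> R}) (xi xihat : nat -> {RV P >-> Xi}) : Prop :=
  (forall t, (0 < t < T)%N ->
    [/\ forall A, measurable A ->
          distribution P (q t) A = uniform_prob (@ltr01 R) A,
        forall A, measurable A -> distribution P (xi t) A = D A &
        forall A, measurable A -> distribution P (xihat t) A = D A]) /\
  mutual_independence [set s | (0 < sample_step s < T)%N]
    (sample_sigma q xi xihat).

End sampling.

(* [x] and [g] are the iterates and momenta of T iterations of Clip NSGDHess *)
Record clip_nsgd_hess (R : realType) (d : nat) (Omega Xi : Type)
    (f : 'rV[R]_d -> Xi -> R) (x0 : 'rV[R]_d)
    (gamma alpha lambda lambda_h : R) (T : nat)
    (q : nat -> Omega -> R) (xi xihat : nat -> Omega -> Xi)
    (x g : nat -> Omega -> 'rV[R]_d) : Prop := ClipNsgdHess {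
  cnh_x0 : forall w, x 0%N w = x0;
  cnh_x1 : forall w, x 1%N w = x0;
  cnh_g0 : forall w, g 0%N w = 0;
  cnh_gS : forall t w, (0 < t < T)%N ->
    let xhat := q t w *: x t w + (1 - q t w) *: x t.-1 w in
    g t w = (1 - alpha) *:
        (g t.-1 w +
         clip ((x t w - x t.-1 w) *m hess (f^~ (xihat t w)) xhat) lambda_h) +
      alpha *: clip (grad (f^~ (xi t w)) (x t w)) lambda;
  cnh_xS : forall t w, (0 < t < T)%N ->
    x t.+1 w = x t w - gamma *: normalize (g t w)
}.

(* The quotients by [ln (T / delta)] are 0 instead of +oo when T = delta = 1, in
   which case "with probability at least 1 - delta" is vacuous. *)
Definition stepsize_bound (R : realType)
    (Delta1 L sigma sigma_h p alpha delta : R) (T : nat) : R :=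
  let n : R := T%:R in
  let ell := ln (n / delta) in
  Num.min (Num.sqrt (Delta1 / (L * n)))
 (Num.min (alpha * Num.sqrt (Delta1 / L))
 (Num.min (Num.sqrt (Delta1 / L) / (alpha * n * ell))
 (Num.min (Delta1 / (sigma * alpha `^ ((p - 1) / p) * n * ell))
          (Num.sqrt (Delta1 * alpha `^ p^-1 / ((L + sigma_h) * n * ell)))))).

Definition avg_grad_norm (R : realType) (d : nat) (Omega : Type)
    (F : 'rV[R]_d -> R) (T : nat) (x : nat -> Omega -> 'rV[R]_d)
    (w : Omega) : R :=
  T%:R^-1 * \sum_(0 <= t < T) l2norm (grad F (x t w)).

(* Main.v *)
Require Import Defs.
From HB Require Import structures.
From mathcomp Require Import all_boot all_order all_algebra finmap.
From mathcomp Require Import all_classical all_reals all_analysis.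
From mathcomp Require Import measurable_realfun ring lra.

Set Implicit Arguments.
Unset Strict Implicit.
Unset Printing Implicit Defensive.

Import Order.TTheory GRing.Theory Num.Theory.
Import numFieldNormedType.Exports.

Local Open Scope classical_set_scope.
Local Open Scope ring_scope.

(* Let [e_t = g_t - grad F (x_t)] and [m = alpha * lambda + lambda_h], and measure
   [e_t] by the smooth potential [phi m e = sqrt (m^2 + |e|^2)].  The normalized
   drift [(phi m e_t - (1 - alpha) * phi m e_(t-1)) / (8 m)] is bounded.  As [q_t]
   is uniform, the mean of the Hessian term is
   [grad F (x_t) - grad F (x_(t-1))], so conditionally on the past the first-order
   part of the drift is only the clipping bias, which like the second moment is
   controlled by the p-th central moments relative to the clipping levels: the
   conditional expectation of its exponential is at most [exp (46 alpha)].  This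
   needs [|grad F (x_t)| <= lambda / 2], which smoothness yields as long as
   [F (x_t) - Fstar <= 2 Delta1]; the exponential supermartingale is therefore
   stopped when this first fails.  By Markov's inequality the drifts sum to at
   most [46 alpha T + ln (1 / delta)] with probability [1 - delta], and
   since [phi m e >= |e|] their sum dominates [alpha * sum |e_t| / (8 m)], up to the
   initial potential.  Inserted in the descent inequality of normalized steps, this
   bound shows that the stopping condition never occurs and bounds the sum of the
   gradient norms. *)

(** * Euclidean norm, clipping and one step of the potential *)

(** The errors are vectors; following the scalar [phi m e_t] replaces a concentration inequality for
    vector martingales and keeps every constant free of [d]. The plain norm has no first-order
    expansion at 0, whereas [phi m] has a remainder of at most [|X|^2 / (2 m)] everywhere. The scale
    [m] is that of one clipped increment, whose norm is at most [3 m / 2]; division by [8 m] then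
    keeps the random part of the exponent below 1/2, where [exp] lies below a quadratic. The factor
    [alpha^(-1/p)] in the clipping levels makes each normalized p-th moment of order [alpha], hence
    a growth of order [alpha] per step.

    A single use of Markov's inequality, at the last time, covers all times: the stopped process is
    frozen after the first failure, so its terminal value is also its value there. As
    [alpha T >= 1], the noise sum is of order [m T log (T / delta)]. Asking that [gamma] times this
    be small against [Delta1] gives the three logarithmic terms of the stepsize condition; the other
    two handle the initial gradient and the curvature. *)

Section euclid.
Context {R : realType} {d : nat}.
Implicit Types u v w : 'rV[R]_d.

Definition dot u v : R := \sum_i u 0 i * v 0 i.

Lemma dotC u v : dot u v = dot v u.
Proof. by apply: eq_bigr => i _; rewrite mulrC. Qed.

Lemma dotDl u v w : dot (u + v) w = dot u w + dot v w.
Proof. by rewrite -big_split; apply: eq_bigr => i _; rewrite mxE mulrDl. Qed.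

Lemma dotZl a u v : dot (a *: u) v = a * dot u v.
Proof. by rewrite mulr_sumr; apply: eq_bigr => i _; rewrite mxE mulrA. Qed.

Lemma dotDr u v w : dot u (v + w) = dot u v + dot u w.
Proof. by rewrite dotC dotDl !(dotC u). Qed.

Lemma dotZr a u v : dot u (a *: v) = a * dot u v.
Proof. by rewrite dotC dotZl dotC. Qed.

Lemma dotNl u v : dot (- u) v = - dot u v.
Proof. by rewrite -scaleN1r dotZl mulN1r. Qed.

Lemma dotNr u v : dot u (- v) = - dot u v.
Proof. by rewrite dotC dotNl dotC. Qed.

Lemma dotBr u v w : dot u (v - w) = dot u v - dot u w.
Proof. by rewrite dotDr dotNr. Qed.

Lemma dot0r u : dot u 0 = 0.
Proof. by rewrite -(scale0r 0) dotZr mul0r. Qed.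

Lemma dot0l u : dot 0 u = 0.
Proof. by rewrite dotC dot0r. Qed.

Lemma dot_ge0 u : 0 <= dot u u.
Proof. by apply: sumr_ge0 => i _; rewrite -expr2 sqr_ge0. Qed.

Lemma l2normE u : l2norm u = Num.sqrt (dot u u).
Proof. by congr Num.sqrt; apply: eq_bigr => i _; rewrite expr2. Qed.

Lemma l2norm_ge0 u : 0 <= l2norm u.
Proof. exact: sqrtr_ge0. Qed.

Lemma l2norm_sqr u : l2norm u ^+ 2 = dot u u.
Proof. by rewrite l2normE sqr_sqrtr // dot_ge0. Qed.

Lemma l2norm0 : l2norm (0 : 'rV[R]_d) = 0.
Proof. by rewrite l2normE dot0r sqrtr0. Qed.

Lemma l2norm_eq0 u : (l2norm u == 0) = (u == 0).
Proof.
apply/eqP/eqP => [u0|->]; last exact: l2norm0.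
have : dot u u = 0 by rewrite -l2norm_sqr u0 expr0n.
move/psumr_eq0P => /(_ (fun i _ => sqr_ge0 (u 0 i))) h.
apply/rowP => i; rewrite mxE; have /eqP := h i isT.
by rewrite sqrf_eq0 => /eqP.
Qed.

Lemma l2normZ a u : l2norm (a *: u) = `|a| * l2norm u.
Proof.
by rewrite !l2normE dotZl dotZr mulrA -expr2 sqrtrM ?sqr_ge0// sqrtr_sqr.
Qed.

Lemma l2normN u : l2norm (- u) = l2norm u.
Proof. by rewrite -scaleN1r l2normZ normrN1 mul1r. Qed.

Lemma dot_le_norm u v : dot u v <= l2norm u * l2norm v.
Proof.
have [->|u0] := eqVneq u 0; first by rewrite dot0l l2norm0 mul0r.
have [->|v0] := eqVneq v 0; first by rewrite dot0r l2norm0 mulr0.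
have pu : 0 < l2norm u by rewrite lt_def l2norm_eq0 u0 l2norm_ge0.
have pv : 0 < l2norm v by rewrite lt_def l2norm_eq0 v0 l2norm_ge0.
have := dot_ge0 (l2norm v *: u - l2norm u *: v).
rewrite !(dotDl, dotDr, dotNl, dotNr, dotZl, dotZr) (dotC v u) -!l2norm_sqr.
move=> h; rewrite -subr_ge0 -(pmulr_rge0 _ (mulr_gt0 pu pv)).
by nra.
Qed.

Lemma ler_l2normD u v : l2norm (u + v) <= l2norm u + l2norm v.
Proof.
rewrite -(@ler_pXn2r _ 2)// ?nnegrE ?addr_ge0 ?l2norm_ge0//.
rewrite l2norm_sqr dotDl !dotDr (dotC v u) sqrrD !l2norm_sqr.
have := dot_le_norm u v; lra.
Qed.

Lemma ler_l2normB u v : l2norm (u - v) <= l2norm u + l2norm v.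
Proof. by rewrite (le_trans (ler_l2normD _ _))// l2normN. Qed.

Lemma l2norm_triangle u v w : l2norm (u - w) <= l2norm (u - v) + l2norm (v - w).
Proof. by rewrite (le_trans _ (ler_l2normD _ _))// addrA subrK. Qed.

Lemma l2norm_sqrD_le u v :
  l2norm (u + v) ^+ 2 <= 2 * (l2norm u ^+ 2 + l2norm v ^+ 2).
Proof.
have := dot_ge0 (u - v).
rewrite !l2norm_sqr !(dotDl, dotDr, dotNl, dotNr) (dotC v u); lra.
Qed.

Lemma ler_coord_l2norm u i : `|u 0 i| <= l2norm u.
Proof.
rewrite -(@ler_pXn2r _ 2)// ?nnegrE ?l2norm_ge0// l2norm_sqr real_normK ?num_real//.
rewrite /dot (bigD1 i)//= -expr2 lerDl sumr_ge0// => j _.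
by rewrite -expr2 sqr_ge0.
Qed.

Definition phi (m : R) v : R := Num.sqrt (m ^+ 2 + dot v v).

Lemma phi_sqr m v : phi m v ^+ 2 = m ^+ 2 + dot v v.
Proof. by rewrite sqr_sqrtr// addr_ge0 ?sqr_ge0 ?dot_ge0. Qed.

Lemma phi_ge0 m v : 0 <= phi m v.
Proof. exact: sqrtr_ge0. Qed.

Lemma phi_ge_l m v : 0 <= m -> m <= phi m v.
Proof.
move=> m0; rewrite -(@ler_pXn2r _ 2)// ?nnegrE ?phi_ge0// phi_sqr lerDl.
exact: dot_ge0.
Qed.

Lemma phi_gt0 m v : 0 < m -> 0 < phi m v.
Proof. by move=> m0; rewrite (lt_le_trans m0)// phi_ge_l// ltW. Qed.

Lemma phi_ge_norm m v : l2norm v <= phi m v.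
Proof.
rewrite -(@ler_pXn2r _ 2)// ?nnegrE ?phi_ge0 ?l2norm_ge0// phi_sqr l2norm_sqr.
by rewrite lerDr sqr_ge0.
Qed.

Lemma phi_le m v : 0 <= m -> phi m v <= m + l2norm v.
Proof.
move=> m0; rewrite -(@ler_pXn2r _ 2)// ?nnegrE ?phi_ge0 ?addr_ge0 ?l2norm_ge0//.
rewrite phi_sqr -l2norm_sqr; have := mulr_ge0 m0 (l2norm_ge0 v); nra.
Qed.

(** Convexity of [phi m] between [v] and 0, where its value is [m]. Divided by [8 * m], the loss
    [a * m] becomes the factor [expR (a / 8)] of [expR_phi_step]. *)
Lemma phi_scale m a v : 0 <= m -> 0 <= a <= 1 ->
  phi m ((1 - a) *: v) <= (1 - a) * phi m v + a * m.
Proof.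
move=> m0 /andP[a0 a1]; have a1' : 0 <= 1 - a by rewrite subr_ge0.
rewrite -(@ler_pXn2r _ 2)// ?nnegrE ?phi_ge0 ?addr_ge0 ?mulr_ge0 ?phi_ge0//.
rewrite phi_sqr dotZl dotZr sqrrD !exprMn phi_sqr.
have : 0 <= (1 - a) * (a * (m * (phi m v - m))).
  by rewrite !mulr_ge0// subr_ge0 phi_ge_l.
by nra.
Qed.

(** The square root lies below its tangent, [sqrt (a^2 + b) <= a + b / (2 a)], and [a >= m] makes
    the curvature at most [1 / m] wherever [e] is. *)
Lemma phi_taylor m e X : 0 < m ->
  phi m (e + X) <= phi m e + dot ((phi m e)^-1 *: e) X + dot X X / (2 * m).
Proof.
move=> m0; set a := phi m e; have a0 : 0 < a by exact: phi_gt0.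
have hX := dot_ge0 X.
set b := 2 * dot e X + dot X X.
have b_ge : - a ^+ 2 <= b.
  by rewrite phi_sqr /b; have := dot_ge0 (e + X);
    rewrite !dotDl !dotDr (dotC X e); have := sqr_ge0 m; lra.
(* The tangent value has to be nonnegative before both sides are squared. *)
have ab : 0 <= a + b / (2 * a).
  have -> : a + b / (2 * a) = (a ^+ 2 + (a ^+ 2 + b)) / (2 * a) by field; lra.
  by rewrite divr_ge0//; have := sqr_ge0 a; lra.
have : phi m (e + X) <= a + b / (2 * a).
  rewrite -(@ler_pXn2r _ 2)// ?nnegrE ?phi_ge0//.
  have -> : phi m (e + X) ^+ 2 = a ^+ 2 + b.
    by rewrite !phi_sqr !dotDl !dotDr (dotC X e) /b; ring.
  have -> : (a + b / (2 * a)) ^+ 2 = a ^+ 2 + b + (b / (2 * a)) ^+ 2.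
    by field; lra.
  by rewrite lerDl sqr_ge0.
move=> /le_trans; apply.
rewrite dotZl -addrA lerD2l.
have -> : b / (2 * a) = a^-1 * dot e X + dot X X / (2 * a).
  by rewrite /b; field; lra.
rewrite lerD2l ler_wpM2l// lef_pV2 ?posrE ?mulr_gt0//.
by rewrite ler_pM2l// phi_ge_l// ltW.
Qed.

Lemma phi_dir_le1 m e : 0 < m -> l2norm ((phi m e)^-1 *: e) <= 1.
Proof.
move=> m0; have a0 := phi_gt0 e m0.
by rewrite l2normZ gtr0_norm ?invr_gt0// mulrC ler_pdivrMr// mul1r phi_ge_norm.
Qed.

End euclid.

Section opnorm.
Context {R : realType} {d : nat}.
Implicit Types (v : 'rV[R]_d) (A : 'M[R]_d).

(** Without boundedness the supremum defining [opnorm] would be a default value. Coordinates of a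
    vector in the unit ball are at most 1, so the row norms of [A] give a bound. *)
Lemma opnorm_has_ubound A :
  has_ubound [set l2norm (v *m A) | v in [set v | l2norm v <= 1]].
Proof.
exists (\sum_i l2norm (row i A)) => _ [v /= v1 <-].
rewrite mulmx_sum_row.
have : l2norm (\sum_i v 0 i *: row i A) <= \sum_i l2norm (v 0 i *: row i A).
  elim/big_ind2: _ => [|x1 y1 x2 y2 h1 h2|//]; first by rewrite l2norm0.
  by rewrite (le_trans (ler_l2normD _ _))// lerD.
move=> /le_trans; apply; apply: ler_sum => i _; rewrite l2normZ.
by rewrite ler_piMl ?l2norm_ge0// (le_trans (ler_coord_l2norm _ _)).
Qed.

Lemma l2norm_mulmx_le v A : l2norm (v *m A) <= opnorm A * l2norm v.
Proof.
have [->|v0] := eqVneq v 0; first by rewrite mul0mx !l2norm0 mulr0.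
have pv : 0 < l2norm v by rewrite lt_def l2norm_eq0 v0 l2norm_ge0.
have : l2norm (((l2norm v)^-1 *: v) *m A) <= opnorm A.
  apply: ub_le_sup; first exact: opnorm_has_ubound.
  exists ((l2norm v)^-1 *: v) => //=.
  by rewrite l2normZ gtr0_norm ?invr_gt0// mulVf// gt_eqF.
by rewrite -scalemxAl l2normZ gtr0_norm ?invr_gt0// mulrC ler_pdivrMr.
Qed.

Lemma opnorm_ge0 A : 0 <= opnorm A.
Proof.
apply: ub_le_sup; first exact: opnorm_has_ubound.
by exists 0 => /=; rewrite ?mul0mx l2norm0.
Qed.

End opnorm.

Section clip.
Context {R : realType} {d : nat}.
Implicit Types u v h : 'rV[R]_d.

Lemma clip_small v (l : R) : l2norm v <= l -> clip v l = v.
Proof.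
move=> vl; rewrite /clip; case: eqP => [->//|/eqP v0].
have pv : 0 < l2norm v by rewrite lt_def l2norm_eq0 v0 l2norm_ge0.
by rewrite min_l ?scale1r// ler_pdivlMr// mul1r.
Qed.

Lemma clip_large v (l : R) : 0 <= l -> l < l2norm v -> clip v l = (l / l2norm v) *: v.
Proof.
move=> l0 vl; have pv := le_lt_trans l0 vl; rewrite /clip -l2norm_eq0 gt_eqF//.
by rewrite min_r// ler_pdivrMr// mul1r ltW.
Qed.

Lemma l2norm_clip_le v (l : R) : 0 <= l -> l2norm (clip v l) <= l.
Proof.
move=> l0; have [vl|vl] := leP (l2norm v) l; first by rewrite clip_small.
have pv := le_lt_trans l0 vl.
by rewrite clip_large// l2normZ ger0_norm ?divfK ?gt_eqF// divr_ge0// ltW.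
Qed.

Lemma l2norm_clip_sub v (l : R) : 0 <= l -> l < l2norm v ->
  l2norm (clip v l - v) = l2norm v - l.
Proof.
move=> l0 vl; have pv := le_lt_trans l0 vl.
rewrite clip_large// -[X in _ - X]scale1r -scalerBl l2normZ ler0_norm; last first.
  by rewrite subr_le0 ler_pdivrMr// mul1r ltW.
by field; rewrite gt_eqF.
Qed.

Lemma sqr_le_powR (r p : R) : p <= 2 -> 0 <= r <= 1 -> r ^+ 2 <= r `^ p.
Proof.
move=> p2 /andP[r0 r1]; have [->|rn0] := eqVneq r 0.
  by rewrite expr0n/= powR_ge0.
by rewrite -powR_mulrn// ger_powR// lt_def rn0 r0.
Qed.

(** The clipped deviation never exceeds [3 l / 2]. If [v] is clipped, [|h| <= l / 2] forces the
    ratio [r] to be at least 1/2, so [r^p >= 1/4], and [9 / 4 = 9 * (1 / 4)] fixes the constant.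
    Otherwise [r^2 <= r^p] for [r <= 1], and [r <= 3 / 2] covers the rest. *)
Lemma clip_dist_sqr v h (l p : R) : 0 < l -> 1 < p <= 2 -> l2norm h <= l / 2 ->
  l2norm (clip v l - h) ^+ 2 <= 9 * l ^+ 2 * (l2norm (v - h) / l) `^ p.
Proof.
move=> l0 /andP[p1 p2] hl; set r := l2norm (v - h) / l.
have r0 : 0 <= r by rewrite divr_ge0 ?l2norm_ge0// ltW.
have rl : l2norm (v - h) = l * r by rewrite /r mulrC divfK// gt_eqF.
have [vl|vl] := leP (l2norm v) l.
  have r1 : r <= 3 / 2.
    by rewrite /r ler_pdivrMr//; have := ler_l2normB v h; lra.
  rewrite clip_small// rl exprMn.
  suff h9 : r ^+ 2 <= 9 * r `^ p.
    by have := ler_wpM2l (sqr_ge0 l) h9; lra.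
  have [r1'|r1'] := leP r 1.
    have := @sqr_le_powR r p p2; rewrite r0 r1' => /(_ isT).
    by have := powR_ge0 r p; lra.
  have : 1 <= r `^ p.
    by rewrite -(powRr0 r) ler_powR ?ltW//; exact: lt_trans p1.
  by nra.
have r1 : 1 / 2 <= r.
  rewrite /r ler_pdivlMr//.
  by have := ler_l2normD (v - h) h; rewrite subrK; lra.
have r4 : 1 / 4 <= r `^ p.
  have [r1'|r1'] := leP r 1.
    have := @sqr_le_powR r p p2; rewrite r0 r1' => /(_ isT); nra.
  suff : 1 <= r `^ p by lra.
  by rewrite -(powRr0 r) ler_powR ?ltW//; exact: lt_trans p1.
have h1 : l2norm (clip v l - h) <= 3 / 2 * l.
  by have := ler_l2normB (clip v l) h; have := l2norm_clip_le v (ltW l0); lra.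
apply: (@le_trans _ _ ((3 / 2 * l) ^+ 2)).
  by rewrite ler_pXn2r// ?nnegrE ?l2norm_ge0// mulr_ge0// ltW.
by have := sqr_ge0 l; nra.
Qed.

(** The linear term [dot u (v - h)] is kept exact because its mean vanishes. The error [|v| - l]
    occurs only when [v] is clipped, hence [r >= 1/2]; it is at most [l * r], and
    [r <= 2 r^2 <= 2 r^p] when also [r <= 1]. *)
Lemma clip_bias u v h (l p : R) : 0 < l -> 1 < p <= 2 -> l2norm h <= l / 2 ->
  l2norm u <= 1 ->
  dot u (clip v l - h) <= dot u (v - h) + 2 * l * (l2norm (v - h) / l) `^ p.
Proof.
move=> l0 /andP[p1 p2] hl u1; set r := l2norm (v - h) / l.
have r0 : 0 <= r by rewrite divr_ge0 ?l2norm_ge0// ltW.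
have rl : l2norm (v - h) = l * r by rewrite /r mulrC divfK// gt_eqF.
have [vl|vl] := leP (l2norm v) l.
  by rewrite clip_small// lerDl !mulr_ge0 ?powR_ge0// ltW.
have -> : clip v l - h = (v - h) + (clip v l - v) by rewrite [RHS]addrC addrA subrK.
rewrite dotDr lerD2l; apply: le_trans (dot_le_norm _ _) _.
rewrite l2norm_clip_sub//; last exact: ltW.
apply: (@le_trans _ _ (l2norm v - l)).
  by rewrite ler_piMl// subr_ge0 ltW.
have hv : l2norm v <= l * r + l2norm h.
  by rewrite -rl; have := ler_l2normD (v - h) h; rewrite subrK.
have r1 : 1 / 2 <= r by rewrite -(ler_pM2l l0); lra.
suff : r <= 2 * r `^ p by have := ltW l0; nra.
have [r1'|r1'] := leP r 1.
  have := @sqr_le_powR r p p2; rewrite r0 r1' => /(_ isT); nra.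
by have := le1r_powR (ltW r1') (ltW p1); lra.
Qed.

End clip.

Section expbound.
Context {R : realType}.
Implicit Types x y : R.

(** From [exp y <= 1 / (1 - y)] and [(1 - y) (1 + y + 2 y^2) = 1 + y^2 (1 - 2 y)]. *)
Lemma expR_le_quadratic y : y <= 1 / 2 -> expR y <= 1 + y + 2 * y ^+ 2.
Proof.
move=> y1; have h : 0 < 1 - y by lra.
have : expR y <= (1 - y)^-1.
  by rewrite -[leLHS]invrK lef_pV2 ?posrE ?invr_gt0 ?expR_gt0// -expRN expR_ge1Dx.
move=> /le_trans; apply.
rewrite -(ler_pM2l h) mulfV ?gt_eqF//.
by have := sqr_ge0 y; nra.
Qed.

End expbound.

Section onestep.
Context {R : realType} {d : nat}.
Implicit Types u e V h : 'rV[R]_d.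

(* [V] and [H] are the unclipped gradient and Hessian samples, [hv] and [hh] their
   means, and [u] is the gradient of [phi m] at [(1 - a) *: e]. *)
Lemma expR_phi_step (m a l lh p : R) u e V hv H hh :
  0 < l -> 0 < lh -> 0 < a <= 1 -> 1 < p <= 2 -> m = a * l + lh ->
  l2norm hv <= l / 2 -> l2norm hh <= lh / 2 ->
  u = (phi m ((1 - a) *: e))^-1 *: ((1 - a) *: e) ->
  expR ((phi m ((1 - a) *: (e + (clip H lh - hh)) + a *: (clip V l - hv))
           - (1 - a) * phi m e) / (8 * m)) <=
  expR (a / 8) * (1 + a / (8 * m) * dot u (V - hv)
    + (1 - a) / (8 * m) * dot u (H - hh)
    + 5 * ((l2norm (V - hv) / l) `^ p + (l2norm (H - hh) / lh) `^ p)).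
Proof.
move=> l0 lh0 /andP[a0 a1] p12 mE hvl hhl uE.
set rG := (l2norm (V - hv) / l) `^ p; set rH := (l2norm (H - hh) / lh) `^ p.
have rG0 : 0 <= rG by exact: powR_ge0.
have rH0 : 0 <= rH by exact: powR_ge0.
have al0 : 0 < a * l by exact: mulr_gt0.
have m0 : 0 < m by rewrite mE addr_gt0.
have u1 : l2norm u <= 1 by rewrite uE phi_dir_le1.
set th := clip V l - hv; set om := clip H lh - hh.
set X := (1 - a) *: om + a *: th.
have -> : (1 - a) *: (e + om) + a *: th = (1 - a) *: e + X.
  by rewrite scalerDr -addrA.
have thl : l2norm th <= 3 / 2 * l.
  by have := ler_l2normB (clip V l) hv; have := l2norm_clip_le V (ltW l0);
    rewrite /th; lra.
have oml : l2norm om <= 3 / 2 * lh.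
  by have := ler_l2normB (clip H lh) hh; have := l2norm_clip_le H (ltW lh0);
    rewrite /om; lra.
have XX : l2norm X <= (1 - a) * l2norm om + a * l2norm th.
  rewrite (le_trans (ler_l2normD _ _))// !l2normZ ger0_norm; last by lra.
  by rewrite gtr0_norm.
have Xm : l2norm X <= 3 / 2 * m.
  by have := l2norm_ge0 om; have := l2norm_ge0 th; rewrite mE; nra.
have Xsq : l2norm X ^+ 2 <= 18 * m ^+ 2 * (rG + rH).
  have h1 : l2norm X ^+ 2 <= 2 * ((1 - a) ^+ 2 * l2norm om ^+ 2 + a ^+ 2 * l2norm th ^+ 2).
    have := l2norm_sqrD_le ((1 - a) *: om) (a *: th).
    by rewrite !l2normZ !exprMn !real_normK ?num_real.
  have h2 : l2norm th ^+ 2 <= 9 * l ^+ 2 * rG by exact: clip_dist_sqr.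
  have h3 : l2norm om ^+ 2 <= 9 * lh ^+ 2 * rH by exact: clip_dist_sqr.
  have h4 : (1 - a) ^+ 2 * l2norm om ^+ 2 <= 9 * m ^+ 2 * rH.
    apply: (@le_trans _ _ (1 * (9 * lh ^+ 2 * rH))).
      apply: ler_pM => //; rewrite ?sqr_ge0//; nra.
    rewrite mul1r ler_wpM2r// ler_pM2l// ler_pXn2r ?nnegrE ?ltW//.
    by rewrite mE; lra.
  have h5 : a ^+ 2 * l2norm th ^+ 2 <= 9 * m ^+ 2 * rG.
    apply: (@le_trans _ _ (a ^+ 2 * (9 * l ^+ 2 * rG))).
      by rewrite ler_wpM2l// sqr_ge0.
    have -> : a ^+ 2 * (9 * l ^+ 2 * rG) = 9 * (a * l) ^+ 2 * rG by ring.
    rewrite ler_wpM2r// ler_pM2l// ler_pXn2r ?nnegrE ?ltW//.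
    by rewrite mE; lra.
  by lra.
have uX : dot u X <= a * dot u (V - hv) + (1 - a) * dot u (H - hh) + 2 * m * (rG + rH).
  have -> : dot u X = (1 - a) * dot u om + a * dot u th by rewrite dotDr !dotZr.
  have h1 : dot u th <= dot u (V - hv) + 2 * l * rG by exact: clip_bias.
  have h2 : dot u om <= dot u (H - hh) + 2 * lh * rH by exact: clip_bias.
  have : a * dot u th <= a * (dot u (V - hv) + 2 * l * rG) by rewrite ler_pM2l.
  have : (1 - a) * dot u om <= (1 - a) * (dot u (H - hh) + 2 * lh * rH).
    by rewrite ler_wpM2l//; lra.
  have : 0 <= a * (lh * rH) by rewrite !mulr_ge0// ltW.
  have : 0 <= lh * rG by rewrite !mulr_ge0// ltW.
  have : 0 <= a * l * rH by rewrite !mulr_ge0// ltW.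
  by rewrite mE; lra.
(* In units of [m]: [s] is the length of the step and [z] its first-order effect. *)
have [s sE] : exists s, l2norm X = m * s.
  by exists (l2norm X / m); rewrite mulrC divfK// gt_eqF.
have s0 : 0 <= s by rewrite -(pmulr_rge0 _ m0) -sE l2norm_ge0.
have s1 : s <= 3 / 2 by rewrite -(ler_pM2l m0) -sE; lra.
have [z zE] : exists z, dot u X = m * z.
  by exists (dot u X / m); rewrite mulrC divfK// gt_eqF.
have uX_le w : dot u w <= l2norm w.
  by apply: le_trans (dot_le_norm _ _) _; rewrite ler_piMl// l2norm_ge0.
have zs : `|z| <= s.
  rewrite ler_norml; apply/andP; split; rewrite -(ler_pM2l m0).
    by have := uX_le (- X); rewrite dotNr l2normN; lra.
  by have := uX_le X; lra.
(* What remains of the exponent beside [a / 8]. As [z <= s <= 3 / 2], it is at most [21 / 64]; this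
   is what the divisor 8 buys. *)
set y := (z + s ^+ 2 / 2) / 8.
have zs2 : - s <= z <= s by rewrite -ler_norml.
have y1 : y <= 1 / 2 by rewrite /y; nra.
have y2 : y ^+ 2 <= s ^+ 2 / 16.
  have hs : `|z + s ^+ 2 / 2| <= 7 / 4 * s by rewrite ler_norml; apply/andP; split; nra.
  have : (z + s ^+ 2 / 2) ^+ 2 <= (7 / 4 * s) ^+ 2.
    by rewrite -[leLHS]real_normK ?num_real// ler_pXn2r ?nnegrE//; lra.
  by rewrite /y; nra.
apply: (@le_trans _ _ (expR (a / 8 + y))).
  rewrite ler_expR ler_pdivrMr ?mulr_gt0//.
  have := phi_taylor ((1 - a) *: e) X m0; rewrite -uE => h1.
  have := @phi_scale _ _ m a e (ltW m0); rewrite a1 ltW// => /(_ isT) h2.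
  have -> : (a / 8 + y) * (8 * m) = a * m + dot u X + dot X X / (2 * m).
    by rewrite -l2norm_sqr sE zE /y; field; lra.
  by lra.
rewrite expRD ler_pM2l ?expR_gt0//.
apply: le_trans (expR_le_quadratic y1) _.
have s2 : s ^+ 2 <= 18 * (rG + rH).
  have m2 : 0 < m ^+ 2 by rewrite exprn_gt0.
  by rewrite -(ler_pM2l m2) -exprMn -sE; lra.
have zb : z <= a / m * dot u (V - hv) + (1 - a) / m * dot u (H - hh) + 2 * (rG + rH).
  rewrite -(ler_pM2l m0) -zE; apply: le_trans uX _.
  by rewrite le_eqVlt; apply/orP; left; apply/eqP; field; lra.
have -> : a / (8 * m) = a / m / 8 by field; lra.
have -> : (1 - a) / (8 * m) = (1 - a) / m / 8 by field; lra.
(* In [1 + y + 2 y^2] the square terms add up to [3 s^2 / 16], at most [27 / 8] times [rG + rH], and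
   the clipping bias in [z / 8] adds [1 / 4]; both fit under the constant 5. *)
by rewrite /y in y2 *; lra.
Qed.

End onestep.

(** * Smooth functions *)

Section real_calculus.
Context {R : realType}.
Implicit Types f df g dg : R -> R.
Notation mu := (@lebesgue_measure R).

Lemma is_derive_quotient_cvg f (s l : R) : is_derive s 1 f l ->
  (f (s + n.+1%:R^-1) - f s) / n.+1%:R^-1 @[n --> \oo] --> l.
Proof.
move=> [fs <-].
have /cvgr_dnbhsP := fs.
move=> /(_ (fun n => n.+1%:R^-1)).
have h : (forall n, n.+1%:R^-1 != 0 :> R) /\ n.+1%:R^-1 @[n --> \oo] --> (0 : R).
  by split; [move=> n; rewrite invr_eq0 pnatr_eq0 | exact: cvg_harmonic].
move=> /(_ h); apply: cvg_trans; apply: near_eq_cvg; apply: nearW => n /=.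
rewrite mulrC; congr (_ * (f _ - _)).
by rewrite addrC [_ *: _]mulr1.
Qed.

Lemma is_derive_continuous f (s l : R) : is_derive s 1 f l -> {for s, continuous f}.
Proof. by move=> [fs _]; apply/differentiable_continuous/derivable1_diffP. Qed.

(* [df] need not be continuous; it is the limit of the difference quotients of [f],
   which are dominated by [K]. *)
Lemma lipschitz_FTC f df (K : R) : (forall s : R, is_derive s 1 f (df s)) ->
  (forall s t, `|f s - f t| <= K * `|s - t|) ->
  mu.-integrable `[0%R, 1%R]%classic (EFin \o df) /\
  (\int[mu]_(s in `[0%R, 1%R]) (df s)%:E = (f 1 - f 0)%:E)%E.
Proof.
move=> fdf fK.
have cf : continuous f by move=> s; exact: is_derive_continuous (fdf s).
have intf a b : mu.-integrable `[a, b] (EFin \o f).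
  apply: continuous_compact_integrable; first exact: segment_compact.
  exact: continuous_subspaceT.
pose h n : R := n.+1%:R^-1.
have h0 n : 0 < h n by rewrite invr_gt0 ltr0n.
have h1 n : h n <= 1 by rewrite invf_le1 ?ler1n ?ltr0n.
pose q n s := (f (s + h n) - f s) / h n.
(* The base point -1 and the end point 3 keep each [s] between -1 and 2, and its shift [s + h n], in
   the interior, so [Phi] is differentiable also at 0 and 1. *)
pose Phi x := (\int[mu]_(t in `[(- 1)%R, x]) f t)%R.
have dPhi (x : R) : - 1 < x < 3 -> is_derive x 1 Phi (f x).
  move=> /andP[x0 x3].
  have [dP PE] := @continuous_FTC1_closed _ f (-1) x 3 x3 (intf _ _) x0 (cf x).
  by split; [exact: dP|rewrite -derive1E PE].
have cq n : continuous (q n).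
  move=> s; apply: cvgM; last exact: cvg_cst.
  apply: cvgB; last exact: cf.
  apply: (@continuous_comp _ _ _ (fun s => s + h n) f); last exact: cf.
  by apply: cvgD; [exact: cvg_id|exact: cvg_cst].
have mq n : measurable_fun (`[0, 1]%classic : set R) (EFin \o q n).
  by apply/measurable_EFinP; apply: measurable_funTS; apply: continuous_measurable_fun; exact: cq.
have qdf s : EFin \o q ^~ s @ \oo --> (df s)%:E.
  by apply: cvg_EFin; [exact: nearW|exact: is_derive_quotient_cvg].
(* A primitive of the quotient [q n]. The integral [G n 1 - G n 0] of [q n] tends to
   [Phi' 1 - Phi' 0 = f 1 - f 0], because [f] itself is continuous. *)
pose G n s := (Phi (s + h n) - Phi s) / h n.
have dG n (s : R) : - 1 < s < 2 -> is_derive s 1 (G n) (q n s).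
  move=> /andP[s0 s2].
  have d1 : is_derive s 1 (fun s => s + h n) 1.
    have -> : (fun s => s + h n) = id + cst (h n) by [].
    by apply: is_derive_eq; rewrite addr0.
  have d2 : is_derive s 1 (Phi \o (fun s => s + h n)) (f (s + h n) * 1).
    apply: is_derive1_comp; apply: dPhi; have := h0 n; have := h1 n; lra.
  have d3 : is_derive s 1 Phi (f s) by apply: dPhi; lra.
  have -> : G n = (h n)^-1 \*: ((Phi \o (fun s => s + h n)) - Phi).
    by apply/funext => z; rewrite /G/= mulrC.
  by apply: is_derive_eq; rewrite mulr1 /q mulrC.
have intq n : (\int[mu]_(s in `[0%R, 1%R]) (q n s)%:E = (G n 1 - G n 0)%:E)%E.
  rewrite EFinB; apply: continuous_FTC2 => //.
  - exact: continuous_subspaceT.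
  - split.
    + by move=> s; rewrite in_itv/= => s01; have [] := dG n s ltac:(lra).
    + by apply/cvg_at_right_filter/is_derive_continuous/dG; lra.
    + by apply/cvg_at_left_filter/is_derive_continuous/dG; lra.
  - move=> s; rewrite in_itv/= => s01; rewrite derive1E.
    by have [] := dG n s ltac:(lra).
have mdf : measurable_fun (`[0, 1]%classic : set R) (EFin \o df).
  by apply: (emeasurable_fun_cvg (fun n => EFin \o q n)) => // s _; exact: qdf.
have [] := @dominated_convergence _ _ _ mu (`[0, 1]%classic : set R) (measurable_itv _)
    (fun n => EFin \o q n) (EFin \o df) (cst K%:E).
- by [].
- by [].
- by apply: aeW => s _; exact: qdf.
- apply: (@continuous_compact_integrable _ (cst K)); first exact: segment_compact.
  by apply: continuous_subspaceT => s; exact: cvg_cst.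
- apply: aeW => s n _ /=; rewrite lee_fin normrM normfV (gtr0_norm (h0 n)).
  rewrite ler_pdivrMr//; apply: le_trans (fK _ _) _.
  by rewrite addrAC subrr add0r gtr0_norm.
move=> idf _ cv; split => //.
apply: (cvg_unique _ cv) => //.
rewrite (_ : [sequence _]_n = fun n => (G n 1 - G n 0)%:E); last first.
  by apply/funext => n /=; rewrite intq.
apply: cvg_EFin; first exact: nearW.
by apply: cvgB; apply: is_derive_quotient_cvg; apply: dPhi; lra.
Qed.

Lemma is_derive_lipschitz_le f (s l K : R) : is_derive s 1 f l ->
  (forall t, `|f t - f s| <= K * `|t - s|) -> `|l| <= K.
Proof.
move=> fl fK.
have /cvg_norm nl := is_derive_quotient_cvg fl.
apply: cvgr_to_le nl _; apply: nearW => n /=.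
have h0 : 0 < n.+1%:R^-1 :> R by rewrite invr_gt0 ltr0n.
rewrite normrM normfV (gtr0_norm h0) ler_pdivrMr//.
by apply: le_trans (fK _) _; rewrite addrAC subrr add0r gtr0_norm.
Qed.

Lemma ler_of_derive_le f df g dg (a b : R) : a <= b ->
  (forall s : R, is_derive s 1 f (df s)) -> (forall s : R, is_derive s 1 g (dg s)) ->
  (forall s, a <= s -> df s <= dg s) -> f b - f a <= g b - g a.
Proof.
move=> ab dF dG le_fg.
have dh (s : R) : is_derive s 1 (g - f) (dg s - df s) by exact: is_deriveB.
have ch : {within `[a, b], continuous (g - f)}.
  by apply: continuous_subspaceT => s; exact: is_derive_continuous (dh s).
have [c cab] := MVT_segment ab (fun x _ => dh x) ch.
rewrite /= => E; suff : 0 <= (g - f) b - (g - f) a by rewrite !fctE; lra.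
rewrite E mulr_ge0// subr_ge0// le_fg//.
by move: cab; rewrite in_itv/= => /andP[].
Qed.

End real_calculus.

Section gradient.
Context {R : realType} {d : nat}.
Implicit Types (g : 'rV[R]_d -> R) (x y v u : 'rV[R]_d).

Lemma is_derive_line (W : normedModType R) (g : 'rV[R]_d -> W) y v (s : R) l :
  is_derive (y + s *: v) v g l -> is_derive s 1 (fun s => g (y + s *: v)) l.
Proof.
move=> [dg <-].
have E : (fun h : R => h^-1 *: (g (y + (h *: 1 + s) *: v) - g (y + s *: v))) =
    (fun h : R => h^-1 *: (g (h *: v + (y + s *: v)) - g (y + s *: v))).
  apply/funext => h; congr (_ *: (g _ - _)).
  by rewrite [h *: 1]mulr1 scalerDl addrCA.
by split; rewrite /derivable /derive /= E.
Qed.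

Lemma derive_grad g x v : differentiable g x -> 'D_v g x = dot (grad g x) v.
Proof.
move=> dg; rewrite deriveE// {1}(row_sum_delta v) linear_sum.
by apply: eq_bigr => i _; rewrite linearZ/= mxE deriveE// mulrC.
Qed.

Lemma is_derive_line_grad g y v (s : R) : (forall x, differentiable g x) ->
  is_derive s 1 (fun s => g (y + s *: v)) (dot (grad g (y + s *: v)) v).
Proof.
move=> dg; apply: is_derive_line; apply: DeriveDef.
  exact: diff_derivable.
exact: derive_grad.
Qed.

Lemma is_derive_line_dot_grad g u y v (s : R) :
  (forall x, differentiable (grad g) x) ->
  is_derive s 1 (fun s => dot u (grad g (y + s *: v)))
    (dot u (v *m hess g (y + s *: v))).
Proof.
move=> dg.
have dv : derivable (grad g) (y + s *: v) v by exact: diff_derivable.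
have di i : is_derive s 1 (fun s => grad g (y + s *: v) 0 i)
    ((v *m hess g (y + s *: v)) 0 i).
  apply: (@is_derive_line _ (fun z => grad g z 0 i)); apply: DeriveDef.
    by move/derivable_mxP : dv.
  by rewrite /hess -deriveEjacobian// derive_mx// mxE.
have -> : (fun s => dot u (grad g (y + s *: v))) =
    \sum_(i < d) (u 0 i \*: (fun s : R => grad g (y + s *: v) 0 i)).
  by apply/funext => z; rewrite fct_sumE.
apply: is_derive_sum => i; exact: is_deriveZ.
Qed.

Section smooth.
Variables (L : R) (F : 'rV[R]_d -> R).
Hypothesis L0 : 0 <= L.
Hypothesis sF : smooth L F.

(** Along the segment the slope of [F] exceeds its initial value by at most [s * L * |v|^2], so
    [ler_of_derive_le] places [F] below a parabola. *)
Lemma smooth_upper x v :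
  F (x + v) <= F x + dot (grad F x) v + L / 2 * l2norm v ^+ 2.
Proof.
have [dF lF] := sF.
pose h (s : R) := s * dot (grad F x) v + s ^+ 2 * (L / 2 * l2norm v ^+ 2).
pose dh (s : R) := dot (grad F x) v + s * (L * l2norm v ^+ 2).
have dhE (s : R) : is_derive s 1 h (dh s).
  have -> : h = dot (grad F x) v \*: id + (L / 2 * l2norm v ^+ 2) \*: (id ^+ 2).
    by apply/funext => z; rewrite /h /= !fctE mulrC [X in _ + X]mulrC.
  apply: is_derive_eq.
  by rewrite /dh /= /GRing.scale/= !mulr1 expr1; field.
have := @ler_of_derive_le _ (fun s => F (x + s *: v)) _ h dh 0 1 ler01
  (fun s => is_derive_line_grad x v s dF) dhE.
rewrite /h !scale0r scale1r addr0 !mul0r expr0n/= mul0r expr1n !mul1r.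
suff H : forall s : R, 0 <= s -> dot (grad F (x + s *: v)) v <= dh s.
  by move=> /(_ H); lra.
move=> s s0; rewrite /dh -lerBlDl.
have -> : dot (grad F (x + s *: v)) v - dot (grad F x) v =
    dot (grad F (x + s *: v) - grad F x) v by rewrite dotDl dotNl.
apply: le_trans (dot_le_norm _ _) _.
have := lF (x + s *: v) x; rewrite addrAC subrr add0r l2normZ ger0_norm//.
by move=> /(ler_wpM2r (l2norm_ge0 v)); lra.
Qed.

(** A gradient step of length [1 / L] lowers [F] by at least [|grad F x|^2 / (2 L)] and cannot fall
    below [Fstar]. *)
Lemma smooth_grad_sqr (Fstar : R) x : 0 < L -> (forall y, Fstar <= F y) ->
  l2norm (grad F x) ^+ 2 <= 2 * L * (F x - Fstar).
Proof.
move=> Lp hF; have := smooth_upper x (- (L^-1 *: grad F x)).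
rewrite dotNr dotZr l2normN l2normZ -l2norm_sqr exprMn gtr0_norm ?invr_gt0//.
have := hF (x - L^-1 *: grad F x); set a := F _; set N := l2norm _ ^+ 2.
have -> : L / 2 * (L^-1 ^+ 2 * N) = L^-1 * N / 2 by field; lra.
move=> h1 h2; have h3 : L^-1 * N <= 2 * (F x - Fstar) by lra.
by have := ler_wpM2l (ltW Lp) h3; rewrite mulrA mulfV ?gt_eqF// mul1r; lra.
Qed.

Hypothesis dF2 : forall x, differentiable (grad F) x.

Lemma dot_grad_lipschitz u y v s t :
  `|dot u (grad F (y + s *: v)) - dot u (grad F (y + t *: v))| <=
  L * l2norm u * l2norm v * `|s - t|.
Proof.
have -> : L * l2norm u * l2norm v * `|s - t| = l2norm u * (L * l2norm ((s - t) *: v)).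
  by rewrite l2normZ; ring.
have [_ lF] := sF.
have := lF (y + s *: v) (y + t *: v).
have -> : y + s *: v - (y + t *: v) = (s - t) *: v.
  by rewrite opprD addrACA subrr add0r -scalerBl.
move=> /(ler_wpM2l (l2norm_ge0 u)); apply: le_trans.
rewrite -dotBr ler_norml dot_le_norm andbT lerNl -dotNr.
by apply: le_trans (dot_le_norm _ _) _; rewrite l2normN.
Qed.

(** Test the gradient against [w = v *m hess F x] itself: its derivative along [v] is [|w|^2], the
    Lipschitz bound is [L * |w| * |v|], and one factor [|w|] cancels. *)
Lemma smooth_hess_le x v : l2norm (v *m hess F x) <= L * l2norm v.
Proof.
set w := v *m hess F x.
have := is_derive_line_dot_grad w x v 0 dF2; rewrite scale0r addr0 => dw.
have : `|dot w w| <= L * l2norm w * l2norm v.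
  by apply: is_derive_lipschitz_le dw _ => t; exact: dot_grad_lipschitz.
rewrite ger0_norm ?dot_ge0// -l2norm_sqr.
have [->|w0] := eqVneq (l2norm w) 0; first by rewrite mulr_ge0// l2norm_ge0.
have pw : 0 < l2norm w by rewrite lt_def w0 l2norm_ge0.
by move=> h; rewrite -(ler_pM2l pw); lra.
Qed.

(** [hess F] may be discontinuous, so this rests on [lipschitz_FTC]. The product with a fixed [u]
    makes it a statement about real functions, and the drift involves the Hessian only through such
    products. *)
Lemma integral_hess_line u y v :
  (@lebesgue_measure R).-integrable `[0%R, 1%R]%classic
    (fun s => (dot u (v *m hess F (y + s *: v)))%:E) /\
  (\int[@lebesgue_measure R]_(s in `[0%R, 1%R]) (dot u (v *m hess F (y + s *: v)))%:E
   = (dot u (grad F (y + v) - grad F y))%:E)%E.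
Proof.
have [h1 h2] := lipschitz_FTC (fun s => is_derive_line_dot_grad u y v s dF2)
  (fun s t => dot_grad_lipschitz u y v s t).
by split => //; rewrite h2 scale1r scale0r addr0 dotBr.
Qed.

End smooth.
End gradient.

(** * Measurability of vector-valued functions *)

Section borel_generation.
Context {R : realType} {d : nat}.

Definition rat_box (k : 'rV[rat]_d * nat) : set 'rV[R]_d :=
  [set y | forall i, `|y 0 i - ratr (k.1 0 i)| < k.2.+1%:R^-1].

(** Second countability. The union runs over all rational cubes, those not inside [U] contributing
    [set0], so that the index type is visibly countable; cubes are coordinate conditions, which ties
    Borel sets to coordinates. *)
Lemma open_bigcup_rat_box (U : set 'rV[R]_d) : open U ->
  U = \bigcup_k (if pselect (rat_box k `<=` U) then rat_box k else set0).
Proof.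
move=> oU; apply/seteqP; split => [x Ux|x [k _]]; last first.
  by case: pselect => //= kU; apply: kU.
have /nbhs_ballP[e /= e0 xeU] : nbhs x U by exact: open_nbhs_nbhs.
have [n [h hE [h0 he]]] : exists n, exists2 h, h = n.+1%:R^-1 & 0 < h /\ h < e / 2.
  have e20 : 0 < e / 2 by rewrite divr_gt0.
  have [n _ /(_ n (leqnn _)) ne] := near_infty_natSinv_lt (PosNum e20).
  by exists n, n.+1%:R^-1 => //; split => //; rewrite invr_gt0 ltr0n.
have rE i : {r : rat | `|x 0 i - ratr r| < h}.
  apply: cid; have lt1 : x 0 i - h < x 0 i + h by lra.
  have [r] := rat_in_itvoo lt1; rewrite in_itv/= => r01.
  by exists r; rewrite ltr_norml; lra.
pose k : 'rV[rat]_d * nat := (\row_i sval (rE i), n).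
have xk i : `|x 0 i - ratr (k.1 0 i)| < h by rewrite mxE; exact: (svalP (rE i)).
exists k => //; case: pselect => [_ i|]; first by rewrite -[k.2]/n -hE.
apply => y yk; apply: xeU; split => // i j; rewrite (ord1 i) /ball/=.
have := yk j; have := xk j; rewrite -[k.2]/n -hE => h1 h2.
have -> : x 0 j - y 0 j = (x 0 j - ratr (k.1 0 j)) - (y 0 j - ratr (k.1 0 j)) by ring.
by apply: le_lt_trans (ler_normB _ _) _; lra.
Qed.

Lemma measurable_fun_borelRV dT (T : measurableType dT) (V : T -> 'rV[R]_d) :
  (forall i, measurable_fun setT (fun w => V w 0 i)) ->
  measurable_fun setT (V : T -> borelRV R d).
Proof.
move=> mV; apply: (@measurability _ _ _ (borelRV R d) setT V (@open 'rV[R]_d)) => // _ [U oU <-].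
rewrite setTI (open_bigcup_rat_box oU) preimage_bigcup.
apply: countable_bigcupT_measurable => [|k]; first exact: countableP.
case: (pselect (rat_box k `<=` U)) => _ /=; last by rewrite preimage_set0.
have -> : V @^-1` rat_box k =
    \bigcap_(i in [set: 'I_d]) [set w | `|V w 0 i - ratr (k.1 0 i)| < k.2.+1%:R^-1].
  by apply/seteqP; split => [w wk i _|w wk i] /=; [exact: wk|exact: (wk i)].
apply: fin_bigcap_measurable => // i _.
rewrite -[X in measurable X]setTI.
apply: (@measurable_fun_ltr _ _ _ setT (fun w => `|V w 0 i - ratr (k.1 0 i)|)
  (cst (k.2.+1%:R^-1))) => //.
apply: measurableT_comp => //; exact: measurable_funB.
Qed.

Lemma measurable_borelRV_continuous (h : 'rV[R]_d -> R) : continuous h ->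
  measurable_fun setT (h : borelRV R d -> R).
Proof.
move=> ch; apply: (measurability _ (RGenOpens.measurableE R)).
move=> _ [_ [a [b ->] <-]]; rewrite setTI; apply: sub_sigma_algebra.
by move/continuousP : ch; apply; exact: interval_open.
Qed.

End borel_generation.

Section measurable_rV.
Context {R : realType} {d : nat} {dT : measure_display} {T : measurableType dT}.
Implicit Types (V W : T -> 'rV[R]_d) (a : T -> R).

(** Stated by coordinates so that vector operations reduce to real ones; [measurable_fun_borelRV]
    converts it where an oracle or a continuous function is composed. *)
Definition measurable_rV V := forall i, measurable_fun setT (fun w => V w 0 i).

Lemma measurable_rV_cst v : measurable_rV (fun=> v).
Proof. by move=> i; exact: measurable_cst. Qed.

Lemma measurable_rVD V W : measurable_rV V -> measurable_rV W ->
  measurable_rV (fun w => V w + W w).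
Proof. by move=> mV mW i; under eq_fun do rewrite mxE; exact: measurable_funD. Qed.

Lemma measurable_rVZ a V : measurable_fun setT a -> measurable_rV V ->
  measurable_rV (fun w => a w *: V w).
Proof. by move=> ma mV i; under eq_fun do rewrite mxE; exact: measurable_funM. Qed.

Lemma measurable_rVN V : measurable_rV V -> measurable_rV (fun w => - V w).
Proof. by move=> mV i; under eq_fun do rewrite mxE; exact: measurable_funN. Qed.

Lemma measurable_rVB V W : measurable_rV V -> measurable_rV W ->
  measurable_rV (fun w => V w - W w).
Proof. by move=> mV mW; apply: measurable_rVD => //; exact: measurable_rVN. Qed.

Lemma measurable_dot V W : measurable_rV V -> measurable_rV W ->
  measurable_fun setT (fun w => dot (V w) (W w)).
Proof.
by move=> mV mW; apply: measurable_sum => i; exact: measurable_funM.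
Qed.

Lemma measurable_sqrt a : measurable_fun setT a ->
  measurable_fun setT (fun w => Num.sqrt (a w)).
Proof.
move=> ma; apply: (@measurableT_comp _ _ _ _ _ _ (@Num.sqrt R)) => //.
by apply: continuous_measurable_fun; exact: sqrt_continuous.
Qed.

Lemma measurable_l2norm V : measurable_rV V ->
  measurable_fun setT (fun w => l2norm (V w)).
Proof.
move=> mV; under eq_fun do rewrite l2normE.
by apply: measurable_sqrt; exact: measurable_dot.
Qed.

Lemma measurable_l2normV V : measurable_rV V ->
  measurable_fun setT (fun w => (l2norm (V w))^-1).
Proof.
move=> mV; under eq_fun do rewrite -powR_inv1 ?l2norm_ge0//.
apply: (@measurableT_comp _ _ _ _ _ _ (fun x : R => x `^ (-1))).
  exact: measurable_powR.
exact: measurable_l2norm.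
Qed.

Lemma measurable_phi (m : R) V : measurable_rV V ->
  measurable_fun setT (fun w => phi m (V w)).
Proof.
move=> mV; apply: measurable_sqrt; apply: measurable_funD => //.
exact: measurable_dot.
Qed.

Lemma clipE (v : 'rV[R]_d) l : clip v l = Num.min 1 (l / l2norm v) *: v.
Proof. by rewrite /clip; case: eqP => [->|//]; rewrite scaler0. Qed.

Lemma measurable_clip V (l : R) : measurable_rV V ->
  measurable_rV (fun w => clip (V w) l).
Proof.
move=> mV i; under eq_fun do rewrite clipE.
apply: measurable_rVZ => //; apply: measurable_minr => //.
by apply: measurable_funM => //; exact: measurable_l2normV.
Qed.

Lemma measurable_normalize V : measurable_rV V ->
  measurable_rV (fun w => normalize (V w)).
Proof. by move=> mV; apply: measurable_rVZ => //; exact: measurable_l2normV. Qed.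

Lemma measurable_mulmx V (A : T -> 'M[R]_d) : measurable_rV V ->
  (forall i j, measurable_fun setT (fun w => A w i j)) ->
  measurable_rV (fun w => V w *m A w).
Proof.
move=> mV mA j; under eq_fun do rewrite mxE.
by apply: measurable_sum => i; exact: measurable_funM.
Qed.

Lemma measurable_rV_comp_continuous V (h : 'rV[R]_d -> R) : continuous h ->
  measurable_rV V -> measurable_fun setT (fun w => h (V w)).
Proof.
move=> ch mV; apply: (@measurableT_comp _ _ _ _ (borelRV R d) _ h).
  exact: measurable_borelRV_continuous.
exact: measurable_fun_borelRV.
Qed.

End measurable_rV.

Lemma measurable_rV_comp {R : realType} {d : nat} {d1 d2 : measure_display}
  {T1 : measurableType d1} {T2 : measurableType d2} (V : T2 -> 'rV[R]_d) (h : T1 -> T2) :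
  measurable_rV V -> measurable_fun setT h -> measurable_rV (fun w => V (h w)).
Proof. by move=> mV mh i; exact: (measurableT_comp (mV i) mh). Qed.

Lemma differentiable_grad_coord_continuous {R : realType} {d : nat}
  (F : 'rV[R]_d -> R) i : (forall x, differentiable (grad F) x) ->
  continuous (fun x => grad F x 0 i).
Proof.
move=> dF x; apply: (@continuous_comp _ _ _ (grad F) (fun M : 'rV[R]_d => M 0 i)).
  exact: differentiable_continuous.
exact: coord_continuous.
Qed.

Section oracle_measurable.
Context {R : realType} {d : nat} {dX dT : measure_display}.
Context {Xi : measurableType dX} {T : measurableType dT}.
Variables (f : 'rV[R]_d -> Xi -> R) (V : T -> 'rV[R]_d) (s : T -> Xi).
Hypotheses (mV : measurable_rV V) (ms : measurable_fun setT s).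

Lemma measurable_oracle_grad :
  (forall i, measurable_fun setT
     (fun z : borelRV R d * Xi => grad (f^~ z.2) z.1 0 i)) ->
  measurable_rV (fun w => grad (f^~ (s w)) (V w)).
Proof.
move=> mf i.
apply: (@measurableT_comp _ _ _ _ (borelRV R d * Xi)%type _
  (fun z => grad (f^~ z.2) z.1 0 i) setT (fun w => (V w, s w))) => //.
by apply: measurable_fun_pair => //; exact: measurable_fun_borelRV.
Qed.

Lemma measurable_oracle_hess :
  (forall i j, measurable_fun setT
     (fun z : borelRV R d * Xi => hess (f^~ z.2) z.1 i j)) ->
  forall i j, measurable_fun setT (fun w => hess (f^~ (s w)) (V w) i j).
Proof.
move=> mf i j.
apply: (@measurableT_comp _ _ _ _ (borelRV R d * Xi)%type _
  (fun z => hess (f^~ z.2) z.1 i j) setT (fun w => (V w, s w))) => //.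
by apply: measurable_fun_pair => //; exact: measurable_fun_borelRV.
Qed.

End oracle_measurable.

(** * Integrating out a fresh independent sample *)

Section past.
Context {R : realType} {dO : measure_display} {Omega : measurableType dO}.
Variable P : probability Omega R.
Context {I : choiceType}.
Variables (S : I -> set_system Omega).
Hypothesis ST : forall j, S j setT.
Hypothesis SI : forall j, setI_closed (S j).
Hypothesis Sm : forall j, S j `<=` measurable.

(** The pi-system generating the joint sigma-algebra of the samples in [A]; on it mutual
    independence is directly a product formula. *)
Definition cylinder (A : {fset I}) : set_system Omega :=
  [set B | exists E, (forall j, j \in A -> S j (E j)) /\
     B = \big[setI/setT]_(j <- A) E j].

Lemma cylinder_setI A : setI_closed (cylinder A).
Proof.
move=> _ _ [E [SE ->]] [E' [SE' ->]]; exists (fun j => E j `&` E' j).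
by split => [j jA|]; [exact: SI (SE j jA) (SE' j jA)|rewrite big_split].
Qed.

Lemma cylinder_setT A : cylinder A setT.
Proof. by exists (fun=> setT); split => [//|]; rewrite big1. Qed.

Lemma cylinder_measurable A : cylinder A `<=` measurable.
Proof.
move=> _ [E [SE ->]]; rewrite big_seq.
elim/big_ind : _ => // [X Y mX mY|j jA]; first exact: measurableI.
exact: Sm (SE j jA).
Qed.

Lemma sub_cylinder (A : {fset I}) j : j \in A -> S j `<=` cylinder A.
Proof.
move=> jA B SB; exists (fun k => if k == j then B else setT); split.
  by move=> k _; case: eqP => [->|].
rewrite (bigD1_seq j)//= eqxx big1 ?setIT// => k kj.
by rewrite (negbTE kj).
Qed.

Variable D : set I.
Hypothesis indep : mutual_independence P D S.
Variables (A : {fset I}) (j : I).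
Hypothesis AD : [set` A] `<=` D.
Hypothesis jD : D j.
Hypothesis jA : j \notin A.

Lemma cylinder_indep C B : cylinder A C -> S j B ->
  (P (C `&` B) = P C * P B)%E.
Proof.
move=> [E [SE ->]] SB.
pose E' k := if k == j then B else E k.
have E'E k : k \in A -> E' k = E k.
  by rewrite /E'; case: eqP => // ->; rewrite (negbTE jA).
have sD : [set` (j |` A)%fset] `<=` D.
  by move=> k /=; rewrite !inE => /predU1P[->//|kA]; exact: AD.
have sE k : k \in (j |` A)%fset -> S k (E' k).
  rewrite !inE => /predU1P[->|kA]; first by rewrite /E' eqxx.
  by rewrite E'E//; exact: SE.
have := indep sD sE; rewrite !big_fsetU1//= {1 3}/E' eqxx.
rewrite (eq_big_seq E) => [|k kA]; last exact: E'E.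
rewrite (eq_big_seq (fun k => P (E k))) => [|k kA]; last by rewrite E'E.
by rewrite -(indep AD SE) setIC muleC.
Qed.

(** Dynkin's argument: for fixed [B], the finite measures [P (C & B)] and [P C * P B] in [C] agree
    on the pi-system of cylinders, hence on what it generates. *)
Lemma g_cylinder_indep C B : <<s cylinder A >> C -> S j B ->
  (P (C `&` B) = P C * P B)%E.
Proof.
move=> + SB; have mB := Sm SB.
have PB : P B \is a fin_num by exact: fin_num_measure.
pose r : {nonneg R} := NngNum (fine_ge0 (measure_ge0 P B)).
have rE Z : mscale r P Z = (P Z * P B)%E.
  by rewrite /mscale -[r%:num]/(fine (P B)) fineK// muleC.
move=> /(@g_sigma_algebra_measure_unique _ _ _ (cylinder A) (@cylinder_measurable A)
  (fun=> setT) (fun=> cylinder_setT A) _ (mrestr P mB) (mscale r P)).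
move=> h; transitivity (mscale r P C); last exact: rE.
apply: h.
- by rewrite bigcup_const//; exists 0%N.
- exact: cylinder_setI.
- by move=> Z cZ; transitivity (P Z * P B)%E; [exact: cylinder_indep|rewrite -rE].
- move=> _; suff : (P (setT `&` B) < +oo)%E by [].
  rewrite setTI; apply: le_lt_trans (probability_le1 P mB) _.
  exact: ltry.
Qed.

(* [Omega] with the sigma-algebra generated by the samples indexed by [A] *)
Definition pastType := g_sigma_algebraType (cylinder A).

Lemma measurable_id_past : measurable_fun setT (id : Omega -> pastType).
Proof.
move=> _ B mB; rewrite setTI preimage_id.
exact: (smallest_sub (@sigma_algebra_measurable _ Omega) (@cylinder_measurable A)).
Qed.

Context {d' : measure_display} {X : measurableType d'} (mu : probability X R).
Variable Y : Omega -> X.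
Hypothesis mY : measurable_fun setT Y.
Hypothesis SY : S j = sigma_of Y.
Hypothesis muY : forall B, measurable B -> P (Y @^-1` B) = mu B.

(** This plays the part of conditioning on the past. By independence the law of the pair formed by
    the past and [Y] is a product measure, and Tonelli's theorem applies. *)
Lemma ge0_integral_past (G : pastType * X -> \bar R) :
  measurable_fun setT G -> (forall z, 0 <= G z)%E ->
  (\int[P]_w G (w, Y w) = \int[P]_w \int[mu]_s G (w, s))%E.
Proof.
move=> mG G0.
have mid := measurable_id_past.
pose idM : {mfun Omega >-> pastType} :=
  HB.pack (id : Omega -> pastType) (isMeasurableFun.Build _ _ _ _ _ mid).
have mp : measurable_fun setT (fun w : Omega => (w : pastType, Y w)).
  exact: measurable_fun_pair.
pose pM : {mfun Omega >-> (pastType * X)%type} :=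
  HB.pack (fun w : Omega => (w : pastType, Y w)) (isMeasurableFun.Build _ _ _ _ _ mp).
have JE : forall Z, measurable Z -> (distribution P idM \x mu)%E Z = distribution P pM Z.
  apply: product_measure_unique => C B mC mB.
  rewrite -[LHS]/(P (C `&` Y @^-1` B)) g_cylinder_indep//; last first.
    by rewrite SY; exists B => //; rewrite setTI.
  by congr (_ * _)%E; exact: muY.
rewrite -[LHS](@ge0_integral_pushforward _ _ _ _ _ pM mp P setT G)//.
rewrite -(@eq_measure_integral _ _ _ _ _ (distribution P idM \x mu)%E); last first.
  by move=> Z mZ _; exact: JE.
rewrite fubini_tonelli1//.
rewrite (@ge0_integral_pushforward _ _ _ _ _ idM mid P setT)//.
  exact: measurable_fun_fubini_tonelli_F.
by move=> w _; exact: integral_ge0.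
Qed.

End past.

(** * Conditional expectation of the potential step *)

Section integral_lemmas.
Context {R : realType} {dX : measure_display} {X : measurableType dX}.

(** The integral of a nonnegative function is a supremum over simple functions below it, hence
    monotone in any case. This serves for the operator norm of the noise, whose measurability is
    never established. *)
Lemma le_integral_nonmeasurable (mu : {measure set X -> \bar R}) (h g : X -> \bar R) :
  (forall x, 0 <= h x)%E -> (forall x, h x <= g x)%E ->
  (\int[mu]_x h x <= \int[mu]_x g x)%E.
Proof.
move=> h0 hg; have g0 x : (0 <= g x)%E by exact: le_trans (h0 x) (hg x).
rewrite !ge0_integralTE//; apply: le_ereal_sup => _ [s /= sh <-].
by exists s => //= x; exact: le_trans (sh x) (hg x).
Qed.

(** The moment conditions only give the value of the expectation. In [\bar R] a difference with an
    infinite part is infinite, so a finite value forces both parts to be finite. *)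
Lemma expectation_fin_integrable (D : probability X R) (V : X -> R) (r : R) :
  measurable_fun setT V -> ('E_D[V] = r%:E)%E ->
  D.-integrable setT (EFin \o V) /\ (\int[D]_x (V x)%:E = r%:E)%E.
Proof.
move=> mV; rewrite unlock => Er; split => //.
have mE : measurable_fun setT (EFin \o V) by exact/measurable_EFinP.
apply/integrableP; split => //.
rewrite (eq_integral ((EFin \o V)^\+ \+ (EFin \o V)^\-)%E); last first.
  by move=> x _; exact: (congr1 (@^~ x) (fune_abse (EFin \o V))).
rewrite ge0_integralD//; last 2 first.
- exact: measurable_funepos.
- exact: measurable_funeneg.
have := integralE D setT (EFin \o V); rewrite [LHS]Er => /esym.
have : (0 <= \int[D]_x ((EFin \o V)^\+ x))%E by exact: integral_ge0.
have : (0 <= \int[D]_x ((EFin \o V)^\- x))%E by exact: integral_ge0.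
move: (\int[D]_x ((EFin \o V)^\+ x))%E (\int[D]_x ((EFin \o V)^\- x))%E.
by case=> [s| |] [t| |]//= _ _ _; rewrite -EFinD ltry.
Qed.

(** The pattern of each of the three integrations: [w1] is a first-order term whose integral is
    known, [w2] a nonnegative noise power. The set [A] admits Lebesgue measure on the unit interval
    besides probabilities. *)
Lemma le_integral_affine (mu : {measure set X -> \bar R}) (A : set X)
    (h : X -> \bar R) (w1 w2 : X -> R) (c i1 i2 : R) :
  measurable A -> mu A = 1%E -> measurable_fun A h -> measurable_fun A w2 ->
  (forall x, 0 <= h x)%E -> (forall x, h x <= (c + w1 x + w2 x)%:E)%E ->
  (forall x, 0 <= w2 x) ->
  mu.-integrable A (EFin \o w1) -> (\int[mu]_(x in A) (w1 x)%:E = i1%:E)%E ->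
  (\int[mu]_(x in A) (w2 x)%:E <= i2%:E)%E ->
  (\int[mu]_(x in A) h x <= (c + i1 + i2)%:E)%E.
Proof.
move=> mA mu1 mh mw2 h0 hle w20 iw1 Iw1 Iw2.
have iw2 : mu.-integrable A (EFin \o w2).
  apply/integrableP; split; first exact/measurable_EFinP.
  under eq_integral do rewrite /= ger0_norm//.
  exact: le_lt_trans Iw2 (ltry _).
have ic : mu.-integrable A (EFin \o cst c).
  apply/integrableP; split; first exact/measurable_EFinP.
  by rewrite /= integral_cst// mu1 mule1 ltry.
have mw1 : measurable_fun A w1 by have /integrableP[/measurable_EFinP] := iw1.
apply: (@le_trans _ _ (\int[mu]_(x in A) (c + w1 x + w2 x)%:E)%E).
  apply: ge0_le_integral => //; apply/measurable_EFinP.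
  by apply: measurable_funD => //; exact: measurable_funD.
under eq_integral do rewrite 2!EFinD.
rewrite integralD//; last exact: integrableD.
rewrite integralD// integral_cst// mu1 mule1 Iw1 !EFinD.
by rewrite leeD2l.
Qed.

Lemma integral_dot_sub {d : nat} (D : probability X R) (V : X -> 'rV[R]_d)
    (u mean : 'rV[R]_d) (b : R) :
  (forall i, D.-integrable setT (fun x => (V x 0 i)%:E) /\
     (\int[D]_x (V x 0 i)%:E = (mean 0 i)%:E)%E) ->
  D.-integrable setT (EFin \o (fun x => b * dot u (V x - mean))) /\
  (\int[D]_x (b * dot u (V x - mean))%:E = 0)%E.
Proof.
move=> hV.
pose h i x := ((b * u 0 i)%:E * (V x 0 i)%:E)%E.
have ih i : D.-integrable setT (h i).
  by apply: integrableZl => //; exact: (hV i).1.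
have E x : (b * dot u (V x - mean))%:E =
    (\sum_(i < d) h i x + (- (b * dot u mean))%:E)%E.
  rewrite dotBr mulrBr EFinD; congr (_ + _)%E.
  by rewrite mulr_sumr -sumEFin; apply: eq_bigr => i _; rewrite /h -EFinM mulrA.
have is_ : D.-integrable setT (fun x => \sum_(i < d) h i x)%E.
  by apply: integrable_sum => // i _.
have ic : D.-integrable setT (EFin \o cst (- (b * dot u mean))).
  exact: finite_measure_integrable_cst.
have -> : (EFin \o (fun x => b * dot u (V x - mean))) =
    (fun x => (\sum_(i < d) h i x)%E + (EFin \o cst (- (b * dot u mean))%R) x)%E.
  by apply/funext => x; exact: E.
split; first exact: integrableD.
under eq_integral do rewrite E.
rewrite integralD// integral_sum//.
rewrite integral_cst//= probability_setT mule1.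
rewrite (eq_bigr (fun i => (b * u 0 i * mean 0 i)%:E)); last first.
  by move=> i _; rewrite integralZl ?(hV i).1 ?(hV i).2//; exact: (hV i).1.
rewrite sumEFin -EFinD; congr EFin; rewrite mulr_sumr.
by under [X in X - _]eq_bigr do rewrite -mulrA; rewrite subrr.
Qed.

Lemma integral_powR_scale (D : probability X R) (V : X -> R) (s l p : R) :
  0 < l -> 0 <= s -> (forall x, 0 <= V x) -> measurable_fun setT V ->
  (\int[D]_x (V x `^ p)%:E <= (s `^ p)%:E)%E ->
  (\int[D]_x ((V x / l) `^ p)%:E <= ((s / l) `^ p)%:E)%E.
Proof.
move=> l0 s0 V0 mV Vs; have l0' : 0 <= l^-1 by rewrite invr_ge0 ltW.
under eq_integral do rewrite powRM// mulrC EFinM.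
rewrite ge0_integralZl//; last 3 first.
- by apply/measurable_EFinP; exact: (measurableT_comp (measurable_powR p) mV).
- by move=> x _; rewrite lee_fin powR_ge0.
- by rewrite lee_fin powR_ge0.
rewrite powRM// [(_ * _)%R]mulrC EFinM.
by rewrite lee_wpmul2l// lee_fin powR_ge0.
Qed.

End integral_lemmas.

(** The sum is at most twice the larger term, and [2^p <= 4]. *)
Lemma powRD_le4 {R : realType} (a b p : R) : 0 <= a -> 0 <= b -> 1 < p <= 2 ->
  (a + b) `^ p <= 4 * (a `^ p + b `^ p).
Proof.
move=> a0 b0 /andP[p1 p2]; have p0 : 0 <= p by lra.
have h2 : 2 `^ p <= 4 :> R.
  have -> : 4 = 2 `^ 2%:R :> R by rewrite powR_mulrn// ; ring.
  by rewrite ler_powR//; lra.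
wlog ab : a b a0 b0 / a <= b.
  move=> H; have [|/ltW ba] := leP a b; first exact: H.
  by rewrite addrC [X in 4 * X]addrC; exact: H.
have : (a + b) `^ p <= (2 * b) `^ p.
  by apply: ge0_ler_powR; rewrite ?nnegrE//; lra.
rewrite powRM// => /le_trans; apply.
have := powR_ge0 a p; have := powR_ge0 b p; nra.
Qed.

Section potential_step.
Context {R : realType} {d : nat} {dX : measure_display} {Xi : measurableType dX}.
Variables (D : probability Xi R) (f : 'rV[R]_d -> Xi -> R) (F : 'rV[R]_d -> R).
Variables (a l lh m : R).
Implicit Types x y g : 'rV[R]_d.

(** The three fresh samples are explicit arguments, so that they can be integrated out while the
    iterates stay fixed. *)
Definition momentum_step x y g (q : R) (sh s : Xi) : 'rV[R]_d :=
  (1 - a) *: (g + clip ((x - y) *m hess (f^~ sh) (q *: x + (1 - q) *: y)) lh) +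
  a *: clip (grad (f^~ s) x) l.

Definition potential_step x y g q sh s : R :=
  (phi m (momentum_step x y g q sh s - grad F x)
     - (1 - a) * phi m (g - grad F y)) / (8 * m).

Context {dT : measure_display} {T : measurableType dT}.
Variables (x y g : T -> 'rV[R]_d) (q : T -> R) (sh s : T -> Xi).
Hypotheses (rf : oracle_regular D f) (dF2 : forall x, differentiable (grad F) x).
Hypotheses (mx : measurable_rV x) (my : measurable_rV y) (mg : measurable_rV g).
Hypotheses (mq : measurable_fun setT q) (msh : measurable_fun setT sh)
  (ms : measurable_fun setT s).

Lemma measurable_rV_grad V : measurable_rV V ->
  measurable_rV (fun w : T => grad F (V w)).
Proof.
move=> mV i; have c := @differentiable_grad_coord_continuous _ _ _ i dF2.
exact: (measurable_rV_comp_continuous c mV).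
Qed.

Lemma measurable_momentum_step :
  measurable_rV (fun w => momentum_step (x w) (y w) (g w) (q w) (sh w) (s w)).
Proof.
case: rf => _ mgr mh.
apply: measurable_rVD; apply: measurable_rVZ => //; last first.
  by apply: measurable_clip; exact: measurable_oracle_grad.
apply: measurable_rVD => //; apply: measurable_clip; apply: measurable_mulmx.
  exact: measurable_rVB.
apply: measurable_oracle_hess => //.
apply: measurable_rVD; apply: measurable_rVZ => //.
exact: measurable_funB.
Qed.

Lemma measurable_potential_step :
  measurable_fun setT
    (fun w => potential_step (x w) (y w) (g w) (q w) (sh w) (s w)).
Proof.
apply: measurable_funM => //; apply: measurable_funB.
  apply: measurable_phi; apply: measurable_rVB; first exact: measurable_momentum_step.
  exact: measurable_rV_grad.
apply: measurable_funM => //; apply: measurable_phi; apply: measurable_rVB => //.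
exact: measurable_rV_grad.
Qed.

End potential_step.

Section conditional_step.
Context {R : realType} {d : nat} {dX : measure_display} {Xi : measurableType dX}.
Variables (D : probability Xi R) (f : 'rV[R]_d -> Xi -> R) (F : 'rV[R]_d -> R).
Variables (L sigma sigma_h p : R).
Hypotheses (L0 : 0 < L) (sigma0 : 0 < sigma) (sigma_h0 : 0 < sigma_h).
Hypotheses (p12 : 1 < p <= 2) (rf : oracle_regular D f) (sF : smooth L F).
Hypothesis dF2 : forall x, differentiable (grad F) x.
Hypotheses (bG : bcm_grad D f F p sigma) (bH : bcm_hess D f F p sigma_h).

Variables (gamma a l lh m : R).
Hypotheses (gamma0 : 0 < gamma) (a01 : 0 < a <= 1) (l0 : 0 < l) (lh0 : 0 < lh).
Hypothesis mE : m = a * l + lh.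
(** Relative to the clipping levels, both noise moments and the smoothness offset have p-th power at
    most [a]. [level_grad], [level_hess], [level_smooth] and [level_lipschitz] supply these
    bounds. *)
Hypotheses (sigma_l : (sigma / l) `^ p <= a)
  (sigmah_lh : (sigma_h / (lh / gamma)) `^ p <= a)
  (L_lh : ((2 * L * gamma) / lh) `^ p <= a) (Llh : L * gamma <= lh / 2).

Let p0 : 0 <= p.
Proof. by case/andP: p12 => p1 _; rewrite (le_trans ler01)// ltW. Qed.

Lemma measurable_grad_sample z : measurable_rV (fun s => grad (f^~ s) z).
Proof.
case: rf => _ mg _; exact: (@measurable_oracle_grad _ _ _ _ _ _ f (fun=> z) id).
Qed.

Lemma measurable_hess_sample z i j :
  measurable_fun setT (fun s => hess (f^~ s) z i j).
Proof.
case: rf => _ _ mh; exact: (@measurable_oracle_hess _ _ _ _ _ _ f (fun=> z) id).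
Qed.

Lemma integral_grad_sample z i :
  D.-integrable setT (fun s => (grad (f^~ s) z 0 i)%:E) /\
  (\int[D]_s (grad (f^~ s) z 0 i)%:E = (grad F z 0 i)%:E)%E.
Proof.
have [h _] := bG z; apply: expectation_fin_integrable => //.
exact: measurable_grad_sample.
Qed.

Lemma integral_hess_sample z (v : 'rV[R]_d) i :
  D.-integrable setT (fun s => ((v *m hess (f^~ s) z) 0 i)%:E) /\
  (\int[D]_s ((v *m hess (f^~ s) z) 0 i)%:E = ((v *m hess F z) 0 i)%:E)%E.
Proof.
have [h _] := bH z.
have hj j := expectation_fin_integrable (measurable_hess_sample z j i) (h j i).
have ih j : D.-integrable setT (fun s => (v 0 j)%:E * (hess (f^~ s) z j i)%:E)%E.
  by apply: integrableZl => //; exact: (hj j).1.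
have E s : ((v *m hess (f^~ s) z) 0 i)%:E =
    (\sum_(j < d) (v 0 j)%:E * (hess (f^~ s) z j i)%:E)%E.
  by rewrite mxE -sumEFin; apply: eq_bigr => j _; rewrite EFinM.
have -> : (fun s => ((v *m hess (f^~ s) z) 0 i)%:E) =
    (fun s => \sum_(j < d) (v 0 j)%:E * (hess (f^~ s) z j i)%:E)%E.
  by apply/funext => s; exact: E.
split; first exact: integrable_sum.
rewrite integral_sum// mxE -sumEFin; apply: eq_bigr => j _.
by rewrite integralZl// ?(hj j).2 -?EFinM//; exact: (hj j).1.
Qed.

Lemma grad_noise z :
  (\int[D]_s ((l2norm (grad (f^~ s) z - grad F z) / l) `^ p)%:E <= a%:E)%E.
Proof.
apply: (@le_trans _ _ ((sigma / l) `^ p)%:E); last by rewrite lee_fin.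
apply: integral_powR_scale => //; first exact: ltW.
- by move=> s; exact: l2norm_ge0.
- apply: measurable_l2norm; apply: measurable_rVB; first exact: measurable_grad_sample.
  exact: measurable_rV_cst.
- by have [_] := bG z; rewrite unlock.
Qed.

Lemma measurable_hess_noise z (v w : 'rV[R]_d) :
  measurable_fun setT (fun s => l2norm (v *m hess (f^~ s) z - w)).
Proof.
apply: measurable_l2norm; apply: measurable_rVB; last exact: measurable_rV_cst.
apply: measurable_mulmx; first exact: measurable_rV_cst.
exact: measurable_hess_sample.
Qed.

(* The deviation is taken from the mean [hh] over the whole segment instead of
   [v *m hess F z], which costs the additional [2 * L * gamma]. *)
Lemma hess_noise z (v hh : 'rV[R]_d) : l2norm v <= gamma -> l2norm hh <= L * gamma ->
  (\int[D]_s ((l2norm (v *m hess (f^~ s) z - hh) / lh) `^ p)%:E <= (8 * a)%:E)%E.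
Proof.
move=> vg hhg; pose k := v *m hess F z.
have kg : l2norm k <= L * gamma.
  apply: le_trans (smooth_hess_le (ltW L0) sF dF2 z v) _.
  by rewrite ler_pM2l.
pose N s := l2norm (v *m hess (f^~ s) z - k).
have N0 s : 0 <= N s by exact: l2norm_ge0.
have mN : measurable_fun setT N by exact: measurable_hess_noise.
pose w s := 4 * (N s / lh) `^ p.
have mpow V : measurable_fun setT V -> measurable_fun setT (fun s : Xi => V s `^ p).
  by move=> mV; exact: (measurableT_comp (measurable_powR p) mV).
(* Since [|v| <= gamma], the vector deviation divided by [gamma] is at most the operator norm
   deviation, and the level becomes [lh / gamma]. *)
have IN : (\int[D]_s ((N s / lh) `^ p)%:E <= a%:E)%E.
  apply: (@le_trans _ _ ((sigma_h / (lh / gamma)) `^ p)%:E); last by rewrite lee_fin.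
  have -> : (fun s => ((N s / lh) `^ p)%:E) =
      (fun s => (((N s / gamma) / (lh / gamma)) `^ p)%:E).
    by apply/funext => s; congr (_ `^ _)%:E; field; rewrite !gt_eqF.
  apply: integral_powR_scale => //; rewrite ?divr_gt0 ?(ltW sigma_h0)//.
  - by move=> s; rewrite divr_ge0// ltW.
  - exact: measurable_funM.
  - have [_] := bH z; rewrite unlock; apply: le_trans.
    apply: le_integral_nonmeasurable => s; first by rewrite lee_fin powR_ge0.
    rewrite lee_fin ge0_ler_powR//; rewrite ?nnegrE.
    + by rewrite divr_ge0// ltW.
    + exact: opnorm_ge0.
    + rewrite ler_pdivrMr// /N /k -mulmxBr.
      apply: le_trans (l2norm_mulmx_le _ _) _.
      by rewrite ler_wpM2l// opnorm_ge0.
(* The deterministic offset [|k - hh| <= 2 * L * gamma]. With the factor 4 of [powRD_le4], offset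
   and noise contribute [4 * a] each. *)
pose c := 4 * (2 * L * gamma / lh) `^ p.
have c0 : 0 <= c by rewrite mulr_ge0// powR_ge0.
have -> : (8 * a)%:E = (4 * a + 0 + 4 * a)%:E by congr EFin; ring.
apply: (@le_trans _ _ (c + 0 + 4 * a)%:E); last first.
  by rewrite lee_fin !lerD2r ler_pM2l.
apply: (@le_integral_affine _ _ _ D setT _ (cst 0) w c 0 (4 * a)) => //.
- exact: probability_setT.
- apply/measurable_EFinP; apply: mpow; apply: measurable_funM => //.
  exact: measurable_hess_noise.
- by apply: measurable_funM => //; apply: mpow; exact: measurable_funM.
- by move=> s; rewrite lee_fin powR_ge0.
- move=> s; rewrite lee_fin /= addr0 /c /w -mulrDr.
  apply: le_trans (powRD_le4 _ _ p12); rewrite ?divr_ge0 ?(ltW lh0)//; last first.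
    by rewrite !mulr_ge0// ltW.
  apply: ge0_ler_powR; rewrite ?nnegrE ?addr_ge0 ?divr_ge0 ?l2norm_ge0 ?(ltW lh0)//.
  + by rewrite !mulr_ge0// ltW.
  + rewrite -mulrDl ler_pM2r ?invr_gt0//.
    apply: le_trans (l2norm_triangle _ k _) _; rewrite [leRHS]addrC lerD2l.
    apply: le_trans (ler_l2normB _ _) _.
    by rewrite -mulrA mulr_natl mulr2n lerD.
- by move=> s; rewrite mulr_ge0// powR_ge0.
- exact: integrable0.
- exact: integral0.
- under eq_integral do rewrite EFinM.
  rewrite ge0_integralZl//; last 2 first.
  + by apply/measurable_EFinP; apply: mpow; exact: measurable_funM.
  + by move=> s _; rewrite lee_fin powR_ge0.
  by rewrite EFinM lee_wpmul2l.
Qed.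

Variables (x y g : 'rV[R]_d).
Hypotheses (xy : l2norm (x - y) <= gamma) (Fx : l2norm (grad F x) <= l / 2).

Local Notation momentum_step := (momentum_step f a l lh x y g).
Local Notation potential_step := (potential_step f F a l lh m x y g).

(** Each integration removes one linear term. Integrating over [s] centres the gradient and over
    [sh] centres the Hessian at the sampled point. Only the integral over [q], which therefore comes
    last, replaces that Hessian by the gradient difference [hh]. *)
Lemma integral_potential_step :
  (\int[uniform_prob (@ltr01 R)]_q \int[D]_sh \int[D]_s
     (expR (potential_step q sh s))%:E <= (expR (46 * a))%:E)%E.
Proof.
have [a0 a1] := andP a01.
have m0 : 0 < m by rewrite mE addr_gt0// mulr_gt0.
pose e := g - grad F y; pose hh := grad F x - grad F y.
pose u := (phi m ((1 - a) *: e))^-1 *: ((1 - a) *: e).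
pose xh q := q *: x + (1 - q) *: y.
pose H q sh := (x - y) *m hess (f^~ sh) (xh q).
pose K := expR (a / 8); have K0 : 0 <= K by exact: expR_ge0.
pose b := (1 - a) / (8 * m).
have K5 : (0 <= (K * 5)%:E)%E by rewrite lee_fin mulr_ge0.
have hhl : l2norm hh <= L * gamma.
  case: sF => _ /(_ x y) /le_trans; apply; by rewrite ler_pM2l.
pose rG s := (l2norm (grad (f^~ s) x - grad F x) / l) `^ p.
pose rH q sh := (l2norm (H q sh - hh) / lh) `^ p.
have step q sh s : expR (potential_step q sh s) <=
    K * (1 + b * dot u (H q sh - hh) + 5 * rH q sh) +
    K * (a / (8 * m)) * dot u (grad (f^~ s) x - grad F x) + K * 5 * rG s.
  have := @expR_phi_step _ _ m a l lh p u e (grad (f^~ s) x) (grad F x) (H q sh) hh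
    l0 lh0 a01 p12 mE Fx (le_trans hhl Llh) erefl.
  have -> : (1 - a) *: (e + (clip (H q sh) lh - hh)) +
      a *: (clip (grad (f^~ s) x) l - grad F x) = momentum_step q sh s - grad F x.
    rewrite /momentum_step -/(H q sh) /e /hh; apply/rowP => i; rewrite !mxE; ring.
  rewrite -/K -/(rG s) -/(rH q sh) -/b -/(potential_step q sh s).
  by move=> /le_trans; apply; rewrite le_eqVlt; apply/orP; left; apply/eqP; ring.
have mE3 : measurable_fun setT
    (fun z : R * (Xi * Xi) => (expR (potential_step z.1 z.2.1 z.2.2))%:E).
  apply/measurable_EFinP; apply: measurableT_comp; first exact: measurable_expR.
  apply: (@measurable_potential_step _ _ _ _ D) => //; try exact: measurable_rV_cst.
  - exact: (measurableT_comp measurable_fst measurable_snd).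
  - exact: (measurableT_comp measurable_snd measurable_snd).
have ge0 q sh s : (0 <= (expR (potential_step q sh s))%:E)%E by rewrite lee_fin expR_ge0.
have mpow V : measurable_fun setT V -> measurable_fun setT (fun s : Xi => V s `^ p).
  by move=> mV; exact: (measurableT_comp (measurable_powR p) mV).
have I1 q sh : (\int[D]_s (expR (potential_step q sh s))%:E <=
    (K * (1 + b * dot u (H q sh - hh) + 5 * rH q sh) + 0 + K * 5 * a)%:E)%E.
  have [iw1 Iw1] := integral_dot_sub u (K * (a / (8 * m))) (integral_grad_sample x).
  apply: (@le_integral_affine _ _ _ D setT _ _ (fun s => K * 5 * rG s) _ _ _
     measurableT _ _ _ _ _ _ iw1 Iw1) => //.
  - exact: probability_setT.
  - apply: (measurableT_comp mE3 (_ : measurable_fun setT (fun s => (q, (sh, s))))).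
    by apply: measurable_fun_pair => //; exact: measurable_fun_pair.
  - apply: measurable_funM => //; apply: mpow; apply: measurable_funM => //.
    apply: measurable_l2norm; apply: measurable_rVB; last exact: measurable_rV_cst.
    exact: measurable_grad_sample.
  - by move=> s; rewrite lee_fin; exact: step.
  - by move=> s; rewrite !mulr_ge0// powR_ge0.
  - under eq_integral do rewrite EFinM.
    rewrite ge0_integralZl//; last 2 first.
    + apply/measurable_EFinP; apply: mpow; apply: measurable_funM => //.
      apply: measurable_l2norm; apply: measurable_rVB; last exact: measurable_rV_cst.
      exact: measurable_grad_sample.
    + by move=> s _; rewrite lee_fin powR_ge0.
    by rewrite [leRHS]EFinM lee_wpmul2l//; exact: grad_noise.
have mE2 : measurable_fun setT (fun z : R * Xi =>
    (\int[D]_s (expR (potential_step z.1 z.2 s))%:E)%E).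
  apply: (@measurable_fun_fubini_tonelli_F _ _ _ _ _ D
    (fun z : (R * Xi) * Xi => (expR (potential_step z.1.1 z.1.2 z.2))%:E)) => //.
  apply: (measurableT_comp mE3 (_ : measurable_fun setT
    (fun z : (R * Xi) * Xi => (z.1.1, (z.1.2, z.2))))).
  apply: measurable_fun_pair.
    exact: (measurableT_comp measurable_fst measurable_fst).
  apply: measurable_fun_pair => //.
  exact: (measurableT_comp measurable_snd measurable_fst).
have I2 q : (\int[D]_sh \int[D]_s (expR (potential_step q sh s))%:E <=
    (K * (1 + 5 * a + b * dot u ((x - y) *m hess F (xh q) - hh)) + 0
       + K * 5 * (8 * a))%:E)%E.
  have [iw1 Iw1] := integral_dot_sub u (K * b) (integral_hess_sample (xh q) (x - y)).
  apply: (@le_integral_affine _ _ _ D setT _ _ (fun sh => K * 5 * rH q sh) _ _ _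
     measurableT _ _ _ _ _ _ iw1 Iw1) => //.
  - exact: probability_setT.
  - apply: (measurableT_comp mE2 (_ : measurable_fun setT (fun s => (q, s)))).
    exact: measurable_fun_pair.
  - apply: measurable_funM => //; apply: mpow; apply: measurable_funM => //.
    exact: measurable_hess_noise.
  - by move=> sh; apply: integral_ge0.
  - move=> sh; apply: le_trans (I1 q sh) _.
    (* The first part has mean zero in [sh]; the second is left for the integral over [q]. *)
    have dE : dot u (H q sh - hh) = dot u (H q sh - (x - y) *m hess F (xh q)) +
        dot u ((x - y) *m hess F (xh q) - hh) by rewrite -dotDr addrA subrK.
    have E (C A B r : R) : C = A + B -> K * (1 + b * C + 5 * r) + 0 + K * 5 * a =
        K * (1 + 5 * a + b * B) + K * b * A + K * 5 * r by move=> ->; ring.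
    by rewrite (E _ _ _ _ dE).
  - by move=> s; rewrite !mulr_ge0// powR_ge0.
  - under eq_integral do rewrite EFinM.
    rewrite ge0_integralZl//; last 2 first.
    + apply/measurable_EFinP; apply: mpow; apply: measurable_funM => //.
      exact: measurable_hess_noise.
    + by move=> s _; rewrite lee_fin powR_ge0.
    by rewrite [leRHS]EFinM lee_wpmul2l//; exact: hess_noise.
have mE1 : measurable_fun setT (fun q : R =>
    (\int[D]_sh \int[D]_s (expR (potential_step q sh s))%:E)%E).
  apply: (@measurable_fun_fubini_tonelli_F _ _ _ _ _ D
    (fun z : R * Xi => \int[D]_s (expR (potential_step z.1 z.2 s))%:E)%E) => // z.
  exact: integral_ge0.
rewrite integral_uniform//; last by move=> q; apply: integral_ge0 => sh _; exact: integral_ge0.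
rewrite subr0 invr1 mul1e.
have [il Il] := integral_hess_line sF dF2 u y (x - y).
have xhE q : xh q = y + q *: (x - y).
  by rewrite /xh scalerBl scale1r scalerBr addrCA.
pose w q := K * b * dot u ((x - y) *m hess F (xh q) - hh).
have wE q : (w q)%:E = ((K * b)%:E * (dot u ((x - y) *m hess F (y + q *: (x - y))))%:E
      + (- (K * b * dot u hh))%:E)%E.
  by rewrite /w xhE dotBr mulrBr EFinB EFinM.
have i1 : lebesgue_measure.-integrable (`[0, 1]%classic : set R)
    (fun q => (K * b)%:E * (dot u ((x - y) *m hess F (y + q *: (x - y))))%:E)%E.
  exact: integrableZl.
have leb1 : lebesgue_measure (`[0%R, 1%R]%classic : set R) = 1%E :> \bar R.
  by rewrite lebesgue_measure_itv/= lte_fin ltr01 oppr0 adde0.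
have i2 : lebesgue_measure.-integrable (`[0, 1]%classic : set R)
    (EFin \o cst (- (K * b * dot u hh))).
  apply: (@continuous_compact_integrable _ (cst (- (K * b * dot u hh)))).
    exact: segment_compact.
  by apply: continuous_subspaceT => z; exact: cvg_cst.
have iw : lebesgue_measure.-integrable (`[0, 1]%classic : set R) (EFin \o w).
  have -> : EFin \o w = (fun q =>
      (K * b)%:E * (dot u ((x - y) *m hess F (y + q *: (x - y))))%:E +
      (EFin \o cst (- (K * b * dot u hh))%R) q)%E.
    by apply/funext => q; exact: wE.
  exact: integrableD.
have Iw : (\int[lebesgue_measure]_(q in `[0%R, 1%R]) (w q)%:E = 0)%E.
  under eq_integral do rewrite wE.
  rewrite integralD// integralZl// Il integral_cst//=.
  rewrite lebesgue_measure_itv/= lte_fin ltr01 oppr0 adde0 mule1.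
  have -> : y + (x - y) = x by rewrite addrC subrK.
  by rewrite -EFinM -EFinD -/hh subrr.
have := @le_integral_affine _ _ _ lebesgue_measure (`[0, 1]%classic : set R)
   (fun q => \int[D]_sh \int[D]_s (expR (potential_step q sh s))%:E)%E w (cst 0)
   (K * (1 + 45 * a)) 0 0 _ leb1.
(* [45 = 5 * (1 + 8)] collects the gradient and Hessian noise, and [K = expR (a / 8)]. *)
have hlast : K * (1 + 45 * a) + 0 + 0 <= expR (46 * a).
  rewrite !addr0 (_ : 46 * a = a + 45 * a); last by ring.
  rewrite expRD ler_pM ?expR_ge1Dx//.
    by rewrite addr_ge0// mulr_ge0// ltW.
  by rewrite /K ler_expR; lra.
rewrite -lee_fin in hlast => h; apply: le_trans hlast; apply: h => //.
- exact: measurable_funTS.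
- by move=> q; apply: integral_ge0 => sh _; exact: integral_ge0.
- move=> q; apply: le_trans (I2 q) _; rewrite /w.
  have E (B : R) : K * (1 + 5 * a + b * B) + 0 + K * 5 * (8 * a) =
      K * (1 + 45 * a) + K * b * B + 0 by ring.
  by rewrite E.
- by rewrite integral0.
Qed.

End conditional_step.

(** * Descent along one trajectory *)

Section trajectory.
Context {R : realType} {d : nat}.
Variables (F : 'rV[R]_d -> R) (Fstar L a m gamma : R).
Implicit Types (xs gs : nat -> 'rV[R]_d).

Definition drift xs gs t : R :=
  (phi m (gs t - grad F (xs t)) - (1 - a) * phi m (gs t.-1 - grad F (xs t.-1)))
    / (8 * m).

(** Cumulative, so that a failure is permanent. The test at [t] looks at [xs t] only, which is
    determined before the samples of step [t]. *)
Fixpoint good xs t : bool :=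
  if t is t'.+1 then
    good xs t' && (F (xs t) - Fstar <= 2 * (F (xs 0%N) - Fstar))
  else true.

Fixpoint stopped_exp xs gs t : R :=
  if t is t'.+1 then
    stopped_exp xs gs t' * (if good xs t then expR (drift xs gs t - 46 * a) else 1)
  else 1.

Lemma stopped_exp_gt0 xs gs t : 0 < stopped_exp xs gs t.
Proof. by elim: t => //= t IH; case: ifP => _; rewrite mulr_gt0// expR_gt0. Qed.

Lemma stopped_exp_good xs gs n : good xs n ->
  stopped_exp xs gs n = expR (\sum_(1 <= t < n.+1) drift xs gs t - 46 * a * n%:R).
Proof.
elim: n => [|n IH]; first by rewrite big_geq// mulr0 subr0 expR0.
move=> gn; have gn' : good xs n by case/andP: gn.
rewrite [LHS]/= -/(good xs n.+1) gn IH// -expRD (big_nat_recr n.+1 1)//=.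
by congr (expR _); rewrite -[in RHS](natr1 n); ring.
Qed.

(** Carries the bound on the terminal value back to the time of the first failure. *)
Lemma stopped_exp_bad xs gs n k : ~~ good xs n.+1 ->
  stopped_exp xs gs (n + k) = stopped_exp xs gs n.
Proof.
move=> bad; elim: k => [|k IH]; first by rewrite addn0.
have b : ~~ good xs (n + k).+1.
  elim: k {IH} => [|k]; first by rewrite addn0.
  by rewrite addnS; apply: contra => /andP[].
by rewrite addnS [LHS]/= -/(good xs (n + k).+1) (negbTE b) mulr1.
Qed.

(** Summing [ph t - (1 - a) * ph t.-1] telescopes up to the contraction, which leaves [a] times the
    sum of the [ph t]. *)
Lemma sum_phi_le xs gs n : 0 < m -> 0 < a <= 1 ->
  a * \sum_(1 <= t < n.+1) l2norm (gs t - grad F (xs t)) <=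
  phi m (gs 0%N - grad F (xs 0%N)) + 8 * m * \sum_(1 <= t < n.+1) drift xs gs t.
Proof.
move=> m0 /andP[a0 a1]; pose ph t := phi m (gs t - grad F (xs t)).
have driftE t : 8 * m * drift xs gs t = ph t - (1 - a) * ph t.-1.
  by rewrite /drift mulrC divfK// gt_eqF// mulr_gt0.
have ph0 t : 0 <= ph t by exact: phi_ge0.
have le1 : a * \sum_(1 <= t < n.+1) l2norm (gs t - grad F (xs t)) <=
    a * \sum_(1 <= t < n.+1) ph t.
  by rewrite ler_pM2l//; apply: ler_sum => t _; exact: phi_ge_norm.
apply: le_trans le1 _; rewrite -/(ph 0%N); clearbody ph.
have E : a * \sum_(1 <= t < n.+1) ph t + (1 - a) * ph n =
    (1 - a) * ph 0%N + 8 * m * \sum_(1 <= t < n.+1) drift xs gs t.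
  elim: n => [|n IH]; first by rewrite !big_geq// !mulr0 add0r addr0.
  rewrite !(big_nat_recr n.+1 1)//= !mulrDr driftE.
  move: IH; move: (8 * m * _) (\sum_(_ <= _ < _) _) (ph _) (ph _) (ph _).
  by move=> S A p2 p1 p0' IH; rewrite [RHS]addrA -IH; ring.
have le2 : 0 <= (1 - a) * ph n by rewrite mulr_ge0 ?subr_ge0.
have le3 : (1 - a) * ph 0%N <= ph 0%N by rewrite ler_piMl// gerBl ltW.
move: E le2 le3; move: (8 * m * _) ((1 - a) * ph n) ((1 - a) * ph 0%N) (a * _) (ph _).
by move=> S B C A p0' E le2 le3; lra.
Qed.

Hypothesis sF : smooth L F.
Hypothesis L0 : 0 <= L.
Hypothesis gamma0 : 0 < gamma.

(** With [e = g - grad F x] and [v] the direction of [g], the decrease is governed by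
    [|g| - dot e v >= |grad F x| - 2 * |e|]. *)
Lemma descent_step (x g : 'rV[R]_d) :
  F (x - gamma *: normalize g) <= F x - gamma * l2norm (grad F x)
    + 2 * gamma * l2norm (g - grad F x) + L / 2 * gamma ^+ 2.
Proof.
(* No move is made when [g = 0], but then [|e| = |grad F x|] and the error term pays for the
   gradient term. *)
have [->|g0] := eqVneq g 0.
  rewrite /normalize !scaler0 subr0 sub0r l2normN.
  have : 0 <= gamma * l2norm (grad F x) by rewrite mulr_ge0 ?l2norm_ge0 ?ltW.
  have : 0 <= L / 2 * gamma ^+ 2 by rewrite mulr_ge0 ?sqr_ge0// divr_ge0.
  rewrite -[2 * gamma * _]mulrA.
  by move: (gamma * _) (L / 2 * _) => A B; lra.
have pg : 0 < l2norm g by rewrite lt_def l2norm_eq0 g0 l2norm_ge0.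
set e := g - grad F x; set v := normalize g.
have v1 : l2norm v = 1.
  by rewrite /v /normalize l2normZ gtr0_norm ?invr_gt0// mulVf// gt_eqF.
have gv : dot g v = l2norm g.
  by rewrite /v /normalize dotZr -l2norm_sqr expr2 mulKf// gt_eqF.
have ev : dot e v <= l2norm e.
  by apply: le_trans (dot_le_norm _ _) _; rewrite v1 mulr1.
have Ng : l2norm (grad F x) <= l2norm g + l2norm e.
  by rewrite (_ : grad F x = g - e) ?ler_l2normB// /e opprB addrC subrK.
have Fv : dot (grad F x) v = l2norm g - dot e v.
  by rewrite -gv /e dotDl dotNl opprB addrC subrK.
have := smooth_upper sF x (- (gamma *: v)).
rewrite dotNr dotZr l2normN l2normZ v1 mulr1 real_normK ?num_real// Fv.
move=> /le_trans; apply; rewrite lerD2r -!addrA lerD2l.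
rewrite -mulNr -mulrA; have -> : - gamma * (l2norm g - dot e v) =
   gamma * (dot e v - l2norm g) by ring.
have -> : - (gamma * l2norm (grad F x)) + 2 * (gamma * l2norm e) =
   gamma * (2 * l2norm e - l2norm (grad F x)) by ring.
by rewrite ler_pM2l//; lra.
Qed.

Variables (T : nat) (xs gs : nat -> 'rV[R]_d).
Hypothesis x1 : xs 1%N = xs 0%N.
Hypothesis g0 : gs 0%N = 0.
Hypothesis xS : forall t, (0 < t < T)%N -> xs t.+1 = xs t - gamma *: normalize (gs t).
Hypothesis F_ge : forall y, Fstar <= F y.

Lemma descent_sum n : (n < T)%N ->
  F (xs n.+1) + gamma * \sum_(1 <= t < n.+1) l2norm (grad F (xs t)) <=
  F (xs 0%N) + 2 * gamma * \sum_(1 <= t < n.+1) l2norm (gs t - grad F (xs t))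
    + n%:R * (L / 2 * gamma ^+ 2).
Proof.
elim: n => [|n IH] nT; first by rewrite !big_geq// x1 !mulr0 mul0r !addr0.
have {IH} := IH (ltnW nT); rewrite !(big_nat_recr n.+1 1)//=.
have := descent_step (xs n.+1) (gs n.+1); rewrite -xS//.
rewrite -(natr1 n) (mulrDl n%:R 1) mul1r !mulrDr.
move: (gamma * \sum_(_ <= _ < _) _) (2 * gamma * \sum_(_ <= _ < _) _) => A B.
move: (gamma * l2norm _) (2 * gamma * l2norm _) (L / 2 * _) => A' B' C.
move: (n%:R * C) (F _) (F _) (F _) => *; lra.
Qed.

Variable b : R.
Hypothesis m0 : 0 < m.
Hypothesis a01 : 0 < a <= 1.
Local Notation D := (F (xs 0%N) - Fstar).
(** The share 9/10 keeps the gap [F (xs t) - Fstar] within [19 / 10 * D], below the stopping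
    threshold [2 * D]; the tenth left over pays for the summand [t = 0], which the sums from 1
    omit. *)
Hypothesis budget : 2 * gamma / a * (m + l2norm (grad F (xs 0%N))
    + 8 * m * (46 * a * T%:R + b)) + T%:R * (L / 2 * gamma ^+ 2) <= 9 / 10 * D.
Hypothesis first_le : gamma * l2norm (grad F (xs 0%N)) <= D / 10.

Lemma noise_sum_le n : (n < T)%N -> good xs n -> stopped_exp xs gs n < expR b ->
  2 * gamma * \sum_(1 <= t < n.+1) l2norm (gs t - grad F (xs t))
    + n%:R * (L / 2 * gamma ^+ 2) <= 9 / 10 * D.
Proof.
have [a0 a1] := andP a01.
move=> nT gn; rewrite stopped_exp_good// ltr_expR ltrBlDl => dr.
apply: le_trans budget; apply: lerD; last first.
  by rewrite ler_wpM2r ?ler_nat 1?ltnW// mulr_ge0 ?sqr_ge0// divr_ge0.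
have -> : 2 * gamma / a * (m + l2norm (grad F (xs 0%N)) + 8 * m * (46 * a * T%:R + b))
   = 2 * gamma * ((m + l2norm (grad F (xs 0%N)) + 8 * m * (46 * a * T%:R + b)) / a).
  by rewrite -!mulrA [a^-1 * _]mulrC.
rewrite ler_pM2l ?mulr_gt0// ler_pdivlMr// mulrC.
apply: le_trans (sum_phi_le xs gs n m0 a01) _; apply: lerD.
  by rewrite g0 sub0r -[l2norm _]l2normN; exact/phi_le/ltW.
rewrite ler_pM2l ?mulr_gt0//; apply: le_trans (ltW dr) _; rewrite lerD2r.
by rewrite ler_pM2l ?mulr_gt0// ler_nat ltnW.
Qed.

Lemma descent_good n : (n < T)%N -> good xs n -> stopped_exp xs gs n < expR b ->
  F (xs n.+1) + gamma * \sum_(1 <= t < n.+1) l2norm (grad F (xs t)) <=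
  F (xs 0%N) + 9 / 10 * D.
Proof.
move=> nT gn wb; have := descent_sum nT; have := noise_sum_le nT gn wb.
move: (gamma * _) (2 * gamma * _) (n%:R * _) (F _) (F _) => *; lra.
Qed.

(** At a first failure the process is already frozen, so the terminal bound holds there as well, and
    the descent inequality contradicts the failure. *)
Lemma good_trajectory n : (n < T)%N -> stopped_exp xs gs T.-1 < expR b -> good xs n.
Proof.
move=> + wb; elim: n => // n IH nT; have nT' := ltnW nT.
have gn := IH nT'; apply/negPn/negP => bad.
have wn : stopped_exp xs gs n < expR b.
  rewrite -(stopped_exp_bad gs (T.-1 - n) bad) subnKC//.
  by rewrite -ltnS prednK// (leq_ltn_trans _ nT).
have := descent_good nT' gn wn.
have : 0 <= gamma * \sum_(1 <= t < n.+1) l2norm (grad F (xs t)).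
  by apply: mulr_ge0; [exact: ltW|apply: sumr_ge0 => t _; exact: l2norm_ge0].
have := F_ge (xs 0%N).
move: bad; rewrite [good _ _]/= -/(good xs n) gn /= -ltNge.
move: (gamma * _) (F (xs n.+1)) (F _) => *; lra.
Qed.

Lemma sum_grad_le : (0 < T)%N -> stopped_exp xs gs T.-1 < expR b ->
  gamma * \sum_(0 <= t < T) l2norm (grad F (xs t)) <= 2 * D.
Proof.
move=> T0 wb; have nT : (T.-1 < T)%N by rewrite prednK.
have h := descent_good nT (good_trajectory nT wb) wb.
rewrite prednK// in h; rewrite (big_ltn T0) mulrDr.
move: h first_le (F_ge (xs T)).
move: (gamma * _) (gamma * _) (F _) (F _) => A B C E h1 h2 h3; lra.
Qed.

End trajectory.

(** * Sigma-algebras of the past and the three samples of one iteration *)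

Section past_monotone.
Context {dO : measure_display} {Omega : measurableType dO} {I : choiceType}.
Variable S : I -> set_system Omega.
Hypothesis ST : forall j, S j setT.

Lemma measurable_past_sub (A A' : {fset I}) : (A `<=` A')%fset ->
  measurable_fun setT (id : pastType S A' -> pastType S A).
Proof.
move=> AA'; apply: (@measurability _ _ (pastType S A') (pastType S A) setT id (cylinder S A)) => //.
move=> _ [_ [E [SE ->]] <-]; rewrite setTI preimage_id big_seq.
elim/big_ind : _ => // [X Y mX mY|j jA]; first exact: measurableI.
apply: sub_sigma_algebra; apply: (sub_cylinder ST _ (SE j jA)).
exact: (fsubsetP AA').
Qed.

Lemma measurable_past_sample (A : {fset I}) j d' (X : measurableType d')
    (Y : Omega -> X) : j \in A -> S j = sigma_of Y ->
  measurable_fun setT (Y : pastType S A -> X).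
Proof.
move=> jA SY _ B mB; rewrite setTI; apply: sub_sigma_algebra.
by apply: (sub_cylinder ST jA); rewrite SY; exists B => //; rewrite setTI.
Qed.

End past_monotone.

Section sigma_of.
Context {dO d' : measure_display} {Omega : measurableType dO} {X : measurableType d'}.
Variable Y : Omega -> X.

Lemma sigma_of_setT : sigma_of Y setT.
Proof. by exists setT => //; rewrite setTI preimage_setT. Qed.

Lemma sigma_of_setI : setI_closed (sigma_of Y).
Proof.
move=> _ _ [A mA <-] [B mB <-]; exists (A `&` B); first exact: measurableI.
by rewrite !setTI preimage_setI.
Qed.

Lemma sigma_of_measurable : measurable_fun setT Y -> sigma_of Y `<=` measurable.
Proof. by move=> mY _ [B mB <-]; exact: mY. Qed.

End sigma_of.

Section samples.
Context {R : realType} {dO dX : measure_display}.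
Context {Omega : measurableType dO} {Xi : measurableType dX}.
Variables (P : probability Omega R) (D : probability Xi R) (T : nat).
Variables (q : nat -> {RV P >-> R}) (xi xihat : nat -> {RV P >-> Xi}).
Hypothesis samp : sampling D T q xi xihat.

Local Notation S := (sample_sigma q xi xihat).

Lemma sample_setT s : S s setT.
Proof. by case: s => [[t|t]|t]; exact: sigma_of_setT. Qed.

Lemma sample_setI s : setI_closed (S s).
Proof. by case: s => [[t|t]|t]; exact: sigma_of_setI. Qed.

Lemma sample_measurable s : S s `<=` measurable.
Proof. by case: s => [[t|t]|t]; apply: sigma_of_measurable; exact: measurable_funP. Qed.

(** The past of [t] stops at step [t - 1]: it determines [x t] and [g t.-1], while the samples of
    step [t] are fresh. Step 0 has no samples, hence the inner case. *)
Fixpoint past_indices t : {fset nat + nat + nat} :=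
  if t is t'.+1 then
    if t' is 0%N then fset0
    else (inl (inr t') |` (inr t' |` (inl (inl t') |` past_indices t')))%fset
  else fset0.

Lemma mem_past_indices t s : (s \in past_indices t) = (0 < sample_step s < t)%N.
Proof.
elim: t => [|[|t] IH]; first by rewrite ltn0 andbF in_fset0.
  by rewrite in_fset0; case: (sample_step s).
rewrite [past_indices _]/= -/(past_indices t.+1) !in_fset1U IH.
have E k : (0 < k < t.+2)%N = (k == t.+1) || (0 < k < t.+1)%N.
  rewrite (ltnS k t.+1) (leq_eqVlt k t.+1).
  by case: eqP => [->|_] //=; rewrite andbT.
rewrite E; case: s {IH} => [[s|s]|s] /=;
  by rewrite !(inj_eq inl_inj, inj_eq inr_inj) //= orbA orbC.
Qed.

(** [ge0_integral_past] is applied to [xi t], then [xihat t], then [q t], the samples not yet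
    treated being counted each time as part of the past. *)
Lemma ge0_integral_samples t (G : Omega -> R * (Xi * Xi) -> \bar R) :
  (0 < t < T)%N -> (forall w z, 0 <= G w z)%E ->
  measurable_fun setT (fun z : pastType S (past_indices t) * (R * (Xi * Xi)) => G z.1 z.2) ->
  (\int[P]_w G w (q t w, (xihat t w, xi t w)) =
   \int[P]_w \int[uniform_prob (@ltr01 R)]_u \int[D]_sh \int[D]_s G w (u, (sh, s)))%E.
Proof.
move=> tT G0 mG; have [lawt indep] := samp; have [lawq lawx lawh] := lawt t tT.
have [t0 tT'] := andP tT.
pose A2 := (inl (inl t) |` past_indices t)%fset; pose A1 := (inr t |` A2)%fset.
have subA2 : (past_indices t `<=` A2)%fset by exact: fsubsetU1.
have subA1 : (past_indices t `<=` A1)%fset by apply: fsubset_trans subA2 _; exact: fsubsetU1.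
have dom A s : [set` A] `<=` [set s | (0 < sample_step s < T)%N] ->
    (0 < sample_step s < T)%N -> [set` (s |` A)%fset] `<=` [set s | (0 < sample_step s < T)%N].
  by move=> hA hs k /=; rewrite in_fset1U => /predU1P[->//|]; exact: hA.
have dom0 : [set` past_indices t] `<=` [set s | (0 < sample_step s < T)%N].
  by move=> k /=; rewrite mem_past_indices => /andP[-> /ltn_trans]; apply.
have dom2 := dom _ (inl (inl t)) dom0 tT.
have dom1 := dom _ (inr t) dom2 tT.
have n1 : inl (inr t) \notin A1 by rewrite !in_fset1U mem_past_indices /= ltnn andbF.
have n2 : inr t \notin A2 by rewrite !in_fset1U mem_past_indices /= ltnn andbF.
have n3 : inl (inl t) \notin past_indices t by rewrite mem_past_indices /= ltnn andbF.
have mq A : inl (inl t) \in A -> measurable_fun setT (q t : pastType S A -> R).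
  by move=> tA; exact: (measurable_past_sample sample_setT tA erefl).
have mh A : inr t \in A -> measurable_fun setT (xihat t : pastType S A -> Xi).
  by move=> tA; exact: (measurable_past_sample sample_setT tA erefl).
pose G1 (z : pastType S A1 * Xi) := G z.1 (q t z.1, (xihat t z.1, z.2)).
have mG1 : measurable_fun setT G1.
  apply: (measurableT_comp mG (_ : measurable_fun setT
    (fun z : pastType S A1 * Xi =>
      ((z.1 : pastType S (past_indices t)), (q t z.1, (xihat t z.1, z.2)))))).
  apply: measurable_fun_pair.
    exact: (measurableT_comp (measurable_past_sub sample_setT subA1) measurable_fst).
  apply: measurable_fun_pair.
    apply: (measurableT_comp (mq A1 _) measurable_fst).
    by rewrite !in_fset1U eqxx orbT.
  apply: measurable_fun_pair; last exact: measurable_snd.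
  apply: (measurableT_comp (mh A1 _) measurable_fst).
  by rewrite !in_fset1U eqxx.
have := @ge0_integral_past R dO Omega P _ S sample_setT sample_setI sample_measurable
  _ indep A1 (inl (inr t)) dom1 tT n1 _ Xi D (xi t) (measurable_funP _) erefl lawx G1 mG1
  (fun z => G0 _ _).
rewrite /G1 /= => ->.
pose G2 (z : pastType S A2 * Xi) := (\int[D]_s G z.1 (q t z.1, (z.2, s)))%E.
have G20 z : (0 <= G2 z)%E by apply: integral_ge0 => s _; exact: G0.
have mG2 : measurable_fun setT G2.
  apply: (@measurable_fun_fubini_tonelli_F _ _ _ _ _ D
    (fun z : (pastType S A2 * Xi) * Xi => G z.1.1 (q t z.1.1, (z.1.2, z.2))))
    => [|z]; last exact: G0.
  apply: (measurableT_comp mG (_ : measurable_fun setT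
    (fun z : (pastType S A2 * Xi) * Xi =>
      ((z.1.1 : pastType S (past_indices t)), (q t z.1.1, (z.1.2, z.2)))))).
  have m11 := measurableT_comp (@measurable_fst _ _ (pastType S A2) Xi)
     (@measurable_fst _ _ (pastType S A2 * Xi)%type Xi).
  apply: measurable_fun_pair.
    exact: (measurableT_comp (measurable_past_sub sample_setT subA2) m11).
  apply: measurable_fun_pair.
    apply: (measurableT_comp (mq A2 _) m11); by rewrite !in_fset1U eqxx.
  apply: measurable_fun_pair; last exact: measurable_snd.
  exact: (measurableT_comp measurable_snd measurable_fst).
have := @ge0_integral_past R dO Omega P _ S sample_setT sample_setI sample_measurable
  _ indep A2 (inr t) dom2 tT n2 _ Xi D (xihat t) (measurable_funP _) erefl lawh G2 mG2
  G20.
rewrite /G2 /= => ->.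
pose G3 (z : pastType S (past_indices t) * R) := (\int[D]_sh \int[D]_s G z.1 (z.2, (sh, s)))%E.
have G30 z : (0 <= G3 z)%E.
  by apply: integral_ge0 => sh _; apply: integral_ge0 => s _; exact: G0.
have mG3 : measurable_fun setT G3.
  apply: (@measurable_fun_fubini_tonelli_F _ _ _ _ _ D
    (fun z : (pastType S (past_indices t) * R) * Xi => \int[D]_s G z.1.1 (z.1.2, (z.2, s)))%E)
    => [|z]; last by apply: integral_ge0 => s _; exact: G0.
  apply: (@measurable_fun_fubini_tonelli_F _ _ _ _ _ D
    (fun z : ((pastType S (past_indices t) * R) * Xi) * Xi => G z.1.1.1 (z.1.1.2, (z.1.2, z.2))))
    => [|z]; last exact: G0.
  apply: (measurableT_comp mG (_ : measurable_fun setT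
    (fun z : ((pastType S (past_indices t) * R) * Xi) * Xi =>
      (z.1.1.1, (z.1.1.2, (z.1.2, z.2)))))).
  have m11 := measurableT_comp (@measurable_fst _ _ (pastType S (past_indices t) * R)%type Xi)
     (@measurable_fst _ _ ((pastType S (past_indices t) * R) * Xi)%type Xi).
  apply: measurable_fun_pair; first exact: (measurableT_comp measurable_fst m11).
  apply: measurable_fun_pair; first exact: (measurableT_comp measurable_snd m11).
  apply: measurable_fun_pair; last exact: measurable_snd.
  exact: (measurableT_comp measurable_snd measurable_fst).
have mqt : measurable_fun setT (q t : Omega -> R) by exact: measurable_funP.
pose U : probability (measurableTypeR R) R := uniform_prob (@ltr01 R).
have := @ge0_integral_past R dO Omega P _ S sample_setT sample_setI sample_measurable
  _ indep (past_indices t) (inl (inl t)) dom0 tT n3 _ (measurableTypeR R) U (q t)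
  mqt erefl lawq G3 mG3
  G30.
by rewrite /G3 /= => ->.
Qed.

End samples.

Lemma ge0_integral3Zl {R : realType} {dX : measure_display} {Xi : measurableType dX}
    (U : probability (measurableTypeR R) R) (D : probability Xi R)
    (h : R * (Xi * Xi) -> \bar R) (c : R) :
  0 <= c -> measurable_fun setT h -> (forall z, 0 <= h z)%E ->
  (\int[U]_u \int[D]_sh \int[D]_s (c%:E * h (u, (sh, s))) =
   c%:E * \int[U]_u \int[D]_sh \int[D]_s h (u, (sh, s)))%E.
Proof.
move=> c0 mh h0.
have c0' : (0 <= c%:E)%E by rewrite lee_fin.
pose I z := (\int[D]_s h (z.1, (z.2, s)))%E.
have I0 z : (0 <= I z)%E by apply: integral_ge0.
have mI : measurable_fun setT I.
  apply: (@measurable_fun_fubini_tonelli_F _ _ _ _ _ D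
    (fun z : (R * Xi) * Xi => h (z.1.1, (z.1.2, z.2)))) => //.
  apply: (measurableT_comp mh (_ : measurable_fun setT
    (fun z : (R * Xi) * Xi => (z.1.1, (z.1.2, z.2))))).
  apply: measurable_fun_pair; first exact: (measurableT_comp measurable_fst measurable_fst).
  apply: measurable_fun_pair => //.
  exact: (measurableT_comp measurable_snd measurable_fst).
pose J u := (\int[D]_sh I (u, sh))%E.
have mJ : measurable_fun setT J by exact: (@measurable_fun_fubini_tonelli_F _ _ _ _ _ D I).
transitivity (\int[U]_u (c%:E * J u))%E; last first.
  by rewrite ge0_integralZl// => u _; exact: integral_ge0.
apply: eq_integral => u _; transitivity (\int[D]_sh (c%:E * I (u, sh)))%E; last first.
  by rewrite ge0_integralZl//; exact: (measurable_fun_pair2 u mI).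
apply: eq_integral => sh _; rewrite ge0_integralZl//.
apply: (measurableT_comp mh (_ : measurable_fun setT (fun s => (u, (sh, s))))).
by apply: measurable_fun_pair => //; exact: measurable_fun_pair.
Qed.

(** * The stopped exponential process *)

Lemma integral_probability_cst {R : realType} {dX : measure_display}
  {X : measurableType dX} (mu : probability X R) (c : R) :
  (\int[mu]_x c%:E = c%:E)%E.
Proof. by rewrite (integral_cst mu measurableT c%:E) /= probability_setT mule1. Qed.

Section process.
Context {R : realType} {d : nat} {dO dX : measure_display}.
Context {Omega : measurableType dO} {Xi : measurableType dX}.
Variables (P : probability Omega R) (D : probability Xi R).
Variables (f : 'rV[R]_d -> Xi -> R) (F : 'rV[R]_d -> R).
Variables (L sigma sigma_h p : R).
Hypotheses (L0 : 0 < L) (sigma0 : 0 < sigma) (sigma_h0 : 0 < sigma_h).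
Hypotheses (p12 : 1 < p <= 2) (rf : oracle_regular D f) (sF : smooth L F).
Hypothesis dF2 : forall x, differentiable (grad F) x.
Hypotheses (bG : bcm_grad D f F p sigma) (bH : bcm_hess D f F p sigma_h).

Variables (gamma a l lh m : R).
Hypotheses (gamma0 : 0 < gamma) (a01 : 0 < a <= 1) (l0 : 0 < l) (lh0 : 0 < lh).
Hypothesis mE : m = a * l + lh.
Hypotheses (sigma_l : (sigma / l) `^ p <= a)
  (sigmah_lh : (sigma_h / (lh / gamma)) `^ p <= a)
  (L_lh : ((2 * L * gamma) / lh) `^ p <= a) (Llh : L * gamma <= lh / 2).

Variables (T : nat) (x0 : 'rV[R]_d) (Fstar : R).
Variables (q : nat -> {RV P >-> R}) (xi xihat : nat -> {RV P >-> Xi}).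
Variables (x g : nat -> Omega -> 'rV[R]_d).
Hypothesis samp : sampling D T q xi xihat.
Hypothesis alg : clip_nsgd_hess f x0 gamma a l lh T q xi xihat x g.
Hypothesis F_ge : forall y, Fstar <= F y.
Hypothesis l_ge : 4 * Num.sqrt (L * (F x0 - Fstar)) <= l.

Local Notation S := (sample_sigma q xi xihat).
Local Notation past := (pastType S \o past_indices).

Lemma momentumE t w : (0 < t < T)%N ->
  g t w = momentum_step f a l lh (x t w) (x t.-1 w) (g t.-1 w) (q t w)
    (xihat t w) (xi t w).
Proof. by move=> tT; rewrite (cnh_gS alg w tT). Qed.

(** The iterates are adapted. All three quantities enter the next momentum, so they go through the
    induction together. *)
Lemma iterates_measurable t : (0 < t <= T)%N ->
  [/\ @measurable_rV R d _ (past t) (x t), @measurable_rV R d _ (past t) (x t.-1)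
    & @measurable_rV R d _ (past t) (g t.-1)].
Proof.
elim: t => // -[|t] IH tT.
  have -> : x 1%N = fun=> x0 by apply/funext => w; exact: (cnh_x1 alg).
  have -> : x 0%N = fun=> x0 by apply/funext => w; exact: (cnh_x0 alg).
  have -> : g 0%N = fun=> 0 by apply/funext => w; exact: (cnh_g0 alg).
  by split; exact: measurable_rV_cst.
have t1T : (0 < t.+1 < T)%N by [].
have [mx my mg] := IH (ltnW t1T).
have sub : (past_indices t.+1 `<=` past_indices t.+2)%fset.
  by apply/fsubsetP => s; rewrite !mem_past_indices => /andP[-> /ltnW].
have mid : measurable_fun setT (id : past t.+2 -> past t.+1).
  exact: (measurable_past_sub (sample_setT q xi xihat) sub).
have mx' : @measurable_rV R d _ (past t.+2) (x t.+1) by exact: (measurable_rV_comp mx mid).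
have my' : @measurable_rV R d _ (past t.+2) (x t) by exact: (measurable_rV_comp my mid).
have mg' : @measurable_rV R d _ (past t.+2) (g t) by exact: (measurable_rV_comp mg mid).
have mgS : @measurable_rV R d _ (past t.+2) (g t.+1).
  have -> : g t.+1 = fun w => momentum_step f a l lh (x t.+1 w) (x t w) (g t w)
      (q t.+1 w) (xihat t.+1 w) (xi t.+1 w).
    by apply/funext => w; exact: momentumE.
  apply: (measurable_momentum_step (D := D)) => //.
  - apply: (measurable_past_sample (sample_setT q xi xihat) (j := inl (inl t.+1))) => //.
    by rewrite mem_past_indices /= ltnSn.
  - apply: (measurable_past_sample (sample_setT q xi xihat) (j := inr t.+1)) => //.
    by rewrite mem_past_indices /= ltnSn.
  - apply: (measurable_past_sample (sample_setT q xi xihat) (j := inl (inr t.+1))) => //.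
    by rewrite mem_past_indices /= ltnSn.
split => //.
have -> : x t.+2 = fun w => x t.+1 w - gamma *: normalize (g t.+1 w).
  by apply/funext => w; rewrite (cnh_xS alg w t1T).
apply: measurable_rVB => //; apply: measurable_rVZ => //.
exact: measurable_normalize.
Qed.

Lemma iterates_measurable_le t k : (0 < k <= t)%N -> (t <= T)%N ->
  [/\ @measurable_rV R d _ (past t) (x k), @measurable_rV R d _ (past t) (x k.-1)
    & @measurable_rV R d _ (past t) (g k.-1)].
Proof.
move=> /andP[k0 kt] tT; have [|mx my mg] := @iterates_measurable k.
  by rewrite k0 (leq_trans kt).
have sub : (past_indices k `<=` past_indices t)%fset.
  by apply/fsubsetP => s; rewrite !mem_past_indices => /andP[-> /leq_trans]; apply.
have mid : measurable_fun setT (id : past t -> past k).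
  exact: (measurable_past_sub (sample_setT q xi xihat) sub).
by split; [exact: (measurable_rV_comp mx mid)|exact: (measurable_rV_comp my mid)|
  exact: (measurable_rV_comp mg mid)].
Qed.

Let W n w := stopped_exp F Fstar a m (x^~ w) (g^~ w) n.

Let cF : continuous F.
Proof. by move=> y; apply: differentiable_continuous; case: sF. Qed.

Lemma measurable_good n t : (n <= t)%N -> (0 < t <= T)%N ->
  @measurable_fun _ _ (past t) bool setT (fun w => good F Fstar (x^~ w) n).
Proof.
move=> + /andP[t0 tT]; elim: n => [|n IH] nt; first exact: measurable_cst.
apply: measurable_and; first exact: (IH (ltnW nt)).
have [mx _ _] := @iterates_measurable_le t n.+1 nt tT.
have [_ mx0 _] := @iterates_measurable_le t 1 t0 tT.
apply: measurable_fun_ler.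
  by apply: measurable_funB => //; exact: (measurable_rV_comp_continuous cF mx).
apply: measurable_funM => //; apply: measurable_funB => //.
exact: (measurable_rV_comp_continuous cF mx0).
Qed.

Lemma measurable_drift n t : (n < t)%N -> (0 < t <= T)%N ->
  @measurable_fun _ _ (past t) R setT (fun w => drift F a m (x^~ w) (g^~ w) n).
Proof.
move=> nt /andP[t0 tT].
have mxg k : (k < t)%N -> @measurable_fun _ _ (past t) R setT
    (fun w => phi m (g k w - grad F (x k w))).
  move=> kt; have [_ mx mg] := @iterates_measurable_le t k.+1 kt tT.
  by apply: measurable_phi; apply: measurable_rVB => //; exact: measurable_rV_grad.
apply: measurable_funM => //; apply: measurable_funB; first exact: mxg.
by apply: measurable_funM => //; apply: mxg; exact: leq_ltn_trans (leq_pred _) nt.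
Qed.

Lemma measurable_stopped_exp n t : (n < t)%N -> (0 < t <= T)%N ->
  @measurable_fun _ _ (past t) R setT (W n).
Proof.
move=> + tT; elim: n => [|n IH] nt; first exact: measurable_cst.
apply: measurable_funM; first exact: (IH (ltnW nt)).
apply: measurable_fun_ifT; [exact: (measurable_good (ltnW nt))| |exact: measurable_cst].
apply: (measurableT_comp (@measurable_expR R)).
by apply: measurable_funB => //; exact: measurable_drift.
Qed.

Lemma iterates_dist t w : (0 < t <= T)%N -> l2norm (x t w - x t.-1 w) <= gamma.
Proof.
case: t => // -[|t] tT.
  by rewrite (cnh_x1 alg) (cnh_x0 alg) subrr l2norm0 ltW.
rewrite (cnh_xS alg w (t := t.+1)) // addrAC subrr add0r l2normN l2normZ gtr0_norm//.
suff N1 : l2norm (normalize (g t.+1 w)) <= 1 by rewrite ler_piMr// ltW.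
rewrite /normalize l2normZ.
have [->|g0] := eqVneq (g t.+1 w) 0; first by rewrite l2norm0 mulr0.
have pg : 0 < l2norm (g t.+1 w) by rewrite lt_def l2norm_eq0 g0 l2norm_ge0.
by rewrite gtr0_norm ?invr_gt0// mulVf// gt_eqF.
Qed.

(** A gap of at most [2 * Delta1] gives [|grad F|^2 <= 4 * L * Delta1]; this is the origin of
    [4 * sqrt (L * Delta1)] in the clipping level. *)
Lemma good_grad_le t w : good F Fstar (x^~ w) t.+1 -> l2norm (grad F (x t.+1 w)) <= l / 2.
Proof.
move=> /andP[_]; rewrite (cnh_x0 alg) => h.
have D0 : 0 <= F x0 - Fstar by rewrite subr_ge0.
apply: (@le_trans _ _ (2 * Num.sqrt (L * (F x0 - Fstar)))); last first.
  rewrite ler_pdivlMr//; apply: le_trans l_ge.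
  by rewrite mulrAC ler_wpM2r ?sqrtr_ge0// -natrM.
rewrite -(@ler_pXn2r _ 2)// ?nnegrE ?l2norm_ge0 ?mulr_ge0 ?sqrtr_ge0//.
have LD0 : 0 <= L * (F x0 - Fstar) by rewrite mulr_ge0// ltW.
rewrite exprMn (sqr_sqrtr LD0).
apply: le_trans (smooth_grad_sqr sF (x t.+1 w) L0 F_ge) _.
have -> : 2 ^+ 2 * (L * (F x0 - Fstar)) = 2 * L * (2 * (F x0 - Fstar)) by ring.
by rewrite ler_pM2l// mulr_gt0.
Qed.

(** Markov's inequality only needs the supermartingale property in integrated form, so no
    conditional expectation is constructed. *)
Lemma stopped_exp_step n : (n.+1 < T)%N ->
  (\int[P]_w (W n.+1 w)%:E <= \int[P]_w (W n w)%:E)%E.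
Proof.
move=> nT; have tT : (0 < n.+1 < T)%N by [].
have tT' : (0 < n.+1 <= T)%N by exact: (ltnW nT).
pose pot w (z : R * (Xi * Xi)) := potential_step f F a l lh m (x n.+1 w) (x n w) (g n w)
  z.1 z.2.1 z.2.2.
pose G w z := (W n w * if good F Fstar (x^~ w) n.+1 then expR (pot w z - 46 * a) else 1)%:E.
have W0 k w : 0 <= W k w by exact/ltW/stopped_exp_gt0.
have G0 w z : (0 <= G w z)%E.
  by rewrite lee_fin mulr_ge0//; case: ifP => // _; exact: expR_ge0.
have [mx my mg] := iterates_measurable tT'.
have mpot : measurable_fun setT (fun z : past n.+1 * (R * (Xi * Xi)) => pot z.1 z.2).
  apply: (measurable_potential_step (D := D)) => //.
  - exact: (measurable_rV_comp mx measurable_fst).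
  - exact: (measurable_rV_comp my measurable_fst).
  - exact: (measurable_rV_comp mg measurable_fst).
  - exact: (measurableT_comp measurable_fst measurable_snd).
  - exact: (measurableT_comp measurable_fst
      (measurableT_comp measurable_snd measurable_snd)).
  - exact: (measurableT_comp measurable_snd
      (measurableT_comp measurable_snd measurable_snd)).
have mG : measurable_fun setT (fun z : past n.+1 * (R * (Xi * Xi)) => G z.1 z.2).
  apply/measurable_EFinP; apply: measurable_funM.
    exact: (measurableT_comp (measurable_stopped_exp (ltnSn n) tT') measurable_fst).
  apply: measurable_fun_ifT => //.
    exact: (measurableT_comp (measurable_good (leqnn _) tT') measurable_fst).
  apply: (measurableT_comp (@measurable_expR R)); exact: measurable_funB.
have -> : (\int[P]_w (W n.+1 w)%:E =
    \int[P]_w G w (q n.+1 w, (xihat n.+1 w, xi n.+1 w)))%E.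
  apply: eq_integral => w _; rewrite /G /W [stopped_exp _ _ _ _ _ _ n.+1]/=.
  have potE : drift F a m (x^~ w) (g^~ w) n.+1 =
      pot w (q n.+1 w, (xihat n.+1 w, xi n.+1 w)).
    by rewrite /drift /= (momentumE w tT).
  by rewrite potE.
rewrite (ge0_integral_samples samp tT G0 mG).
apply: le_integral_nonmeasurable => w.
  by apply: integral_ge0 => u _; apply: integral_ge0 => sh _; apply: integral_ge0.
(* Stopping is decided by the past, so under the inner integrals it is a fixed boolean. *)
rewrite /G; case: (boolP (good F Fstar (x^~ w) n.+1)) => [gd|_]; last first.
  by rewrite mulr1 !integral_probability_cst.
pose h (z : R * (Xi * Xi)) := (expR (pot w z))%:E.
have mh : measurable_fun setT h.
  apply/measurable_EFinP; apply: (measurableT_comp (@measurable_expR R)).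
  exact: (measurable_fun_pair2 (w : past n.+1) mpot).
have c0 : 0 <= W n w * expR (- (46 * a)) by rewrite mulr_ge0// expR_ge0.
have -> : (\int[uniform_prob (@ltr01 R)]_u \int[D]_sh \int[D]_s
      (W n w * expR (pot w (u, (sh, s)) - 46 * a))%:E =
    \int[uniform_prob (@ltr01 R)]_u \int[D]_sh \int[D]_s
      ((W n w * expR (- (46 * a)))%:E * h (u, (sh, s))))%E.
  apply: eq_integral => u _; apply: eq_integral => sh _; apply: eq_integral => s _.
  by rewrite /h -EFinM expRD mulrA mulrAC.
rewrite ge0_integral3Zl//; last by move=> z; rewrite lee_fin expR_ge0.
have step := @integral_potential_step R d dX Xi D f F L sigma sigma_h p L0 sigma0
  sigma_h0 p12 rf sF dF2 bG bH gamma a l lh m gamma0 a01 l0 lh0 mE sigma_l sigmah_lh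
  L_lh Llh (x n.+1 w) (x n w) (g n w) (iterates_dist w tT') (good_grad_le gd).
apply: (@le_trans _ _ ((W n w * expR (- (46 * a)))%:E * (expR (46 * a))%:E)%E).
  by apply: lee_wpmul2l; [rewrite lee_fin|exact: step].
by rewrite -EFinM -mulrA -expRD addrC subrr expR0 mulr1.
Qed.

Lemma integral_stopped_exp n : (n < T)%N -> (\int[P]_w (W n w)%:E <= 1)%E.
Proof.
elim: n => [|n IH] nT.
  have -> : (fun w => (W 0 w)%:E) = cst 1%E by [].
  by rewrite integral_cst//= probability_setT mule1.
by apply: le_trans (stopped_exp_step nT) _; exact: (IH (ltnW nT)).
Qed.

Lemma past_measurable t (h : Omega -> R) :
  @measurable_fun _ _ (past t) R setT h -> measurable_fun setT h.
Proof.
have mid : measurable_fun setT (id : Omega -> past t).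
  by apply: measurable_id_past; exact: sample_measurable.
by move=> mh; exact: (measurableT_comp mh mid).
Qed.

Lemma stopped_exp_tail (delta : R) : 0 < delta -> (0 < T)%N ->
  let A := [set w | W T.-1 w < delta^-1] in
  measurable A /\ ((1 - delta)%:E <= P A)%E.
Proof.
move=> delta0 T0 A; have nT : (T.-1 < T)%N by rewrite prednK.
have mW : measurable_fun setT (W T.-1).
  by apply: (@past_measurable T); apply: measurable_stopped_exp => //; rewrite T0 leqnn.
have mA : measurable A.
  rewrite -[X in measurable X]setTI.
  exact: (@measurable_fun_ltr _ _ _ setT (W T.-1) (cst delta^-1)).
split => //.
have W0 w : 0 <= W T.-1 w by exact/ltW/stopped_exp_gt0.
have PC : (P (~` A) <= delta%:E)%E.
  have mC := measurableC mA.
  have h1 : ((delta^-1)%:E * P (~` A) <= 1)%E.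
    apply: le_trans (integral_stopped_exp nT).
    have -> : P (~` A) = (\int[P]_w (\1_(~` A) w)%:E)%E.
      by rewrite integral_indic// setIT.
    rewrite -ge0_integralZl//; last 2 first.
    - by apply/measurable_EFinP; exact: measurable_indic.
    - by rewrite lee_fin invr_ge0 ltW.
    apply: le_integral_nonmeasurable => w.
      by rewrite mule_ge0// lee_fin// invr_ge0 ltW.
    rewrite -EFinM lee_fin indicE; have [wA|_] := boolP (w \in ~` A); last by rewrite mulr0.
    by rewrite mulr1 leNgt; apply/negP => wA'; move: wA; rewrite inE /A /=; apply.
  have := lee_wpmul2l (_ : (0 <= delta%:E)%E) h1; rewrite lee_fin ltW// => /(_ isT).
  by rewrite muleA -EFinM mulfV ?gt_eqF// mul1e mule1.
have -> : A = ~` (~` A) by rewrite setCK.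
rewrite probability_setC; last exact: measurableC.
by rewrite EFinB; apply: leeB.
Qed.

Lemma measurable_avg_grad_norm (c : R) : (0 < T)%N ->
  measurable [set w | avg_grad_norm F T x w <= c].
Proof.
move=> T0; rewrite -[X in measurable X]setTI.
apply: (@measurable_fun_ler _ _ _ setT (avg_grad_norm F T x) (cst c)) => //.
apply: (@past_measurable T); apply: measurable_funM => //.
rewrite (_ : (fun w => _) = (fun w => \sum_(i < T) l2norm (grad F (x i w)))); last first.
  by apply/funext => w; rewrite big_mkord.
apply: measurable_sum => i; apply: measurable_l2norm; apply: measurable_rV_grad => //.
have [_ mx _] := @iterates_measurable_le T i.+1 (ltn_ord i) (leqnn T).
exact: mx.
Qed.

End process.

(** * Parameters *)

Section parameters.
Context {R : realType}.

Lemma powR_inv_le (p a z : R) : 1 < p -> 0 <= a -> 0 <= z -> z <= a `^ p^-1 ->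
  z `^ p <= a.
Proof.
move=> p1 a0 z0 za; have p0 : 0 < p by exact: lt_trans p1.
apply: (@le_trans _ _ ((a `^ p^-1) `^ p)).
  by apply: ge0_ler_powR; rewrite ?nnegrE ?powR_ge0// ltW.
by rewrite -powRrM mulVf ?gt_eqF// powRr1.
Qed.

Lemma ln_ge_half (z : R) : 2 <= z -> 1 / 2 <= ln z.
Proof.
move=> z2; have z0 : 0 < z by exact: lt_le_trans z2.
rewrite -ler_expR lnK ?posrE//; apply: le_trans z2.
by apply: le_trans (expR_le_quadratic (lexx _)) _; lra.
Qed.

Variable c : R.
Hypotheses (c0 : 0 < c) (c_le : 200 * (200 * c) <= 1).

(** In units of [c * D] the terms are at most [746 * 12] for the noise, 4 for the initial gradient
    and 1/2 for the curvature. Their sum stays below 9000, whereas [9 / 10 * D] is at least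
    36000. *)
Lemma budget_arith (gamma a m N n ell b L D : R) :
  0 < gamma -> 0 < a -> 0 <= m -> 0 <= D -> 1 <= a * n -> 1 / 2 <= ell -> b <= ell ->
  gamma * m * n * ell <= 6 * (c * D) -> gamma * N <= 2 * (a * (c * D)) ->
  L * n * gamma ^+ 2 <= c * D ->
  2 * gamma / a * (m + N + 8 * m * (46 * a * n + b)) + n * (L / 2 * gamma ^+ 2)
    <= 9 / 10 * D.
Proof.
move=> g0 a0 m0 D0 an el bel h1 h2 h3.
have cD : 200 * (200 * (c * D)) <= D.
  by have := ler_wpM2r D0 c_le; rewrite mul1r -!mulrA.
have cD0 : 0 <= c * D by rewrite mulr_ge0// ltW.
have hN : 2 * gamma / a * N <= 4 * (c * D).
  have -> : 2 * gamma / a * N = (2 * (gamma * N)) / a by rewrite -!mulrA [a^-1 * N]mulrC.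
  by rewrite ler_pdivrMr//; lra.
have gm0 : 0 <= gamma * m by rewrite mulr_ge0// ltW.
(* [746 = 2 + 736 + 8], by [1 <= 2 * ell], [1 <= a * n] and [b <= ell]. *)
have hb : 1 + 8 * (46 * a * n + b) <= 746 * (a * n * ell).
  have e1 : 0 <= (a * n - 1) * ell by rewrite mulr_ge0; lra.
  have e2 : 0 <= a * n * (ell - 1 / 2) by rewrite mulr_ge0; lra.
  by lra.
have hM : 2 * gamma / a * (m * (1 + 8 * (46 * a * n + b))) <= 746 * (12 * (c * D)).
  have -> : 2 * gamma / a * (m * (1 + 8 * (46 * a * n + b))) =
      (2 * (gamma * m * (1 + 8 * (46 * a * n + b)))) / a by ring.
  rewrite ler_pdivrMr//.
  by have := ler_wpM2l gm0 hb; have := ler_wpM2l (ltW a0) h1; lra.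
have -> : m + N + 8 * m * (46 * a * n + b) = m * (1 + 8 * (46 * a * n + b)) + N by ring.
by rewrite mulrDr; lra.
Qed.

(** * Consequences of the choice of momentum, clipping levels and stepsize *)

Section stepsize.
Variables (Delta L sigma sigma_h p n ell a : R).
Hypotheses (L0 : 0 < L) (sigma0 : 0 < sigma) (sigma_h0 : 0 < sigma_h).
Hypotheses (p1 : 1 < p) (D0 : 0 < Delta) (n1 : 1 <= n).
Hypothesis aE : a = n `^ (- (p / (2 * p - 1))).

Local Notation r := (Num.sqrt (L * Delta)).
Local Notation B1 := (Num.sqrt (Delta / (L * n))).
Local Notation B2 := (a * Num.sqrt (Delta / L)).
Local Notation B3 := (Num.sqrt (Delta / L) / (a * n * ell)).
Local Notation B4 := (Delta / (sigma * a `^ ((p - 1) / p) * n * ell)).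
Local Notation B5 := (Num.sqrt (Delta * a `^ p^-1 / ((L + sigma_h) * n * ell))).
Local Notation bound := (Num.min B1 (Num.min B2 (Num.min B3 (Num.min B4 B5)))).

Lemma n_gt0 : 0 < n. Proof. exact: lt_le_trans n1. Qed.
Local Hint Resolve n_gt0 : core.

Lemma two_p_gt0 : 0 < 2 * p - 1. Proof. by have := p1; lra. Qed.
Local Hint Resolve two_p_gt0 : core.

Lemma p_gt0 : 0 < p. Proof. exact: lt_trans p1. Qed.
Local Hint Resolve p_gt0 : core.

Lemma r_gt0 : 0 < r. Proof. by rewrite sqrtr_gt0 mulr_gt0. Qed.
Local Hint Resolve r_gt0 : core.

Lemma alpha_gt0 : 0 < a. Proof. by rewrite aE powR_gt0. Qed.
Local Hint Resolve alpha_gt0 : core.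

Lemma alpha_le1 : a <= 1.
Proof.
have h : - (p / (2 * p - 1)) <= 0 by rewrite oppr_le0 divr_ge0// ltW.
by rewrite aE -[leRHS](powRr0 n) ler_powR.
Qed.

Lemma alphaM : a * n = n `^ ((p - 1) / (2 * p - 1)).
Proof.
rewrite aE -[X in _ * X](powRr1 (ltW n_gt0)) -powRD ?(gt_eqF n_gt0) ?implybT//.
by congr (_ `^ _); field; rewrite gt_eqF.
Qed.

Lemma alphaM_ge1 : 1 <= a * n.
Proof.
have h : 0 <= (p - 1) / (2 * p - 1).
  by rewrite divr_ge0 ?(ltW two_p_gt0)// subr_ge0 ltW.
by rewrite alphaM -[leLHS](powRr0 n) ler_powR.
Qed.

Lemma alpha_root_gt0 : 0 < a `^ p^-1. Proof. exact: powR_gt0. Qed.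
Local Hint Resolve alpha_root_gt0 : core.

Lemma alpha_root_le1 : a `^ p^-1 <= 1.
Proof.
by rewrite -(powRr0 a) ger_powR ?alpha_gt0 ?alpha_le1// invr_ge0 ltW.
Qed.

Lemma sqrt_mul_div : Num.sqrt (Delta / L) * r = Delta.
Proof.
rewrite -sqrtrM ?divr_ge0 ?(ltW L0) ?(ltW D0)//.
have -> : Delta / L * (L * Delta) = Delta ^+ 2 by field; rewrite gt_eqF.
by rewrite sqrtr_sqr gtr0_norm.
Qed.

Lemma L_sigma_gt0 : 0 < L + sigma_h. Proof. exact: addr_gt0. Qed.
Local Hint Resolve L_sigma_gt0 : core.

Section levels.
Variable gamma : R.
Hypothesis gamma0 : 0 < gamma.
Local Notation l := (Num.max (4 * r) (sigma / a `^ p^-1)).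
Local Notation lh := (2 * gamma * (L + sigma_h) / a `^ p^-1).

Lemma level_gt0 : 0 < l.
Proof. by rewrite lt_max mulr_gt0. Qed.

Lemma level_h_gt0 : 0 < lh.
Proof. by rewrite divr_gt0// !mulr_gt0. Qed.

(** Here and in the next two lemmas the level contains the noise scale divided by [a^(1/p)], so the
    ratio is at most [a^(1/p)], whose p-th power is [a]. *)
Lemma level_grad : (sigma / l) `^ p <= a.
Proof.
have h : sigma / l <= a `^ p^-1.
  rewrite ler_pdivrMr ?level_gt0// mulrC -ler_pdivrMr//.
  by rewrite le_max lexx orbT.
by apply: powR_inv_le => //; [exact: ltW|rewrite divr_ge0// ltW// level_gt0].
Qed.

Lemma level_hess : (sigma_h / (lh / gamma)) `^ p <= a.
Proof.
have E : sigma_h / (lh / gamma) = a `^ p^-1 * (sigma_h / (2 * (L + sigma_h))).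
  by field; rewrite !gt_eqF.
have s0 : 0 <= sigma_h / (2 * (L + sigma_h)) by rewrite divr_ge0 ?mulr_ge0 ?ltW.
have s1 : sigma_h / (2 * (L + sigma_h)) <= 1.
  by rewrite ler_pdivrMr ?mulr_gt0//; have := L0; have := sigma_h0; lra.
apply: powR_inv_le => //; rewrite ?(ltW alpha_gt0)// E.
  by rewrite mulr_ge0// ltW.
by rewrite ler_piMr// ltW.
Qed.

Lemma level_smooth : (2 * L * gamma / lh) `^ p <= a.
Proof.
have E : 2 * L * gamma / lh = a `^ p^-1 * (L / (L + sigma_h)).
  by field; rewrite !gt_eqF.
have s0 : 0 <= L / (L + sigma_h) by rewrite divr_ge0 ?ltW.
have s1 : L / (L + sigma_h) <= 1 by rewrite ler_pdivrMr//; have := sigma_h0; lra.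
apply: powR_inv_le => //; rewrite ?(ltW alpha_gt0)// E.
  by rewrite mulr_ge0// ltW.
by rewrite ler_piMr// ltW.
Qed.

Lemma level_lipschitz : L * gamma <= lh / 2.
Proof.
have -> : lh / 2 = gamma * (L + sigma_h) / a `^ p^-1 by field; rewrite gt_eqF.
have Lg : 0 <= L * gamma by rewrite mulr_ge0// ltW.
rewrite ler_pdivlMr//; apply: (@le_trans _ _ (L * gamma)).
  by rewrite ler_piMr// alpha_root_le1.
by rewrite mulrC ler_pM2l// lerDl ltW.
Qed.

Hypothesis gle : gamma <= c * bound.

Lemma gamma_le_bound z : bound <= z -> gamma <= c * z.
Proof. by move=> h; apply: le_trans gle _; rewrite ler_pM2l. Qed.

Lemma gamma_le1 : gamma <= c * B1.
Proof. by apply: gamma_le_bound; rewrite ge_min lexx. Qed.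

Lemma gamma_le2 : gamma <= c * B2.
Proof. by apply: gamma_le_bound; rewrite !ge_min lexx !orbT. Qed.

Lemma gamma_le3 : gamma <= c * B3.
Proof. by apply: gamma_le_bound; rewrite !ge_min lexx !orbT. Qed.

Lemma gamma_le4 : gamma <= c * B4.
Proof. by apply: gamma_le_bound; rewrite !ge_min lexx !orbT. Qed.

Lemma gamma_le5 : gamma <= c * B5.
Proof. by apply: gamma_le_bound; rewrite !ge_min lexx !orbT. Qed.

Lemma stepsize_grad (N : R) : 0 <= N -> N ^+ 2 <= 2 * L * Delta ->
  gamma * N <= 2 * (a * (c * Delta)).
Proof.
move=> N0 hN; have LD : 0 <= L * Delta by rewrite mulr_ge0// ltW.
have Nr : N <= 2 * r.
  rewrite -(@ler_pXn2r _ 2)// ?nnegrE ?mulr_ge0 ?(ltW r_gt0)//.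
  by rewrite exprMn (sqr_sqrtr LD); lra.
apply: (@le_trans _ _ (c * B2 * (2 * r))).
  by apply: ler_pM => //; [exact: ltW|exact: gamma_le2].
have -> : c * B2 * (2 * r) = 2 * (a * (c * (Num.sqrt (Delta / L) * r))) by ring.
by rewrite sqrt_mul_div.
Qed.

Lemma stepsize_smooth : L * n * gamma ^+ 2 <= c * Delta.
Proof.
have Ln : 0 < L * n by rewrite mulr_gt0.
have DLn : 0 <= Delta / (L * n) by rewrite divr_ge0// ltW.
have h : gamma ^+ 2 <= (c * B1) ^+ 2.
  rewrite ler_pXn2r ?nnegrE ?(ltW gamma0)//; first exact: gamma_le1.
  by rewrite mulr_ge0 ?sqrtr_ge0// ltW.
apply: (@le_trans _ _ (L * n * (c * B1) ^+ 2)); first by rewrite ler_pM2l.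
rewrite exprMn (sqr_sqrtr DLn).
have -> : L * n * (c ^+ 2 * (Delta / (L * n))) = c * (c * Delta).
  by field; rewrite !gt_eqF.
rewrite ler_pM2l// ler_piMl ?(ltW D0)//; have := c_le; have := c0; lra.
Qed.

Hypothesis ell_ge : 1 / 2 <= ell.

Lemma ell_gt0 : 0 < ell. Proof. by have := ell_ge; lra. Qed.
Local Hint Resolve ell_gt0 : core.

(** [B3] and [B4] control the two branches of the maximum [l], at a cost of at most 4, and [B5]
    controls [lh], at a cost of 2. *)
Lemma stepsize_level : gamma * (a * l + lh) * n * ell <= 6 * (c * Delta).
Proof.
have anl : 0 < a * n * ell by rewrite !mulr_gt0.
have cD : 0 < c * Delta by rewrite mulr_gt0.
have h3 : gamma * (a * n * ell) * r <= c * Delta.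
  apply: (@le_trans _ _ (c * B3 * (a * n * ell) * r)).
    by rewrite ler_pM2r// ler_pM2r//; exact: gamma_le3.
  have -> : c * B3 * (a * n * ell) * r = c * (Num.sqrt (Delta / L) * r).
    by field; rewrite !gt_eqF.
  by rewrite sqrt_mul_div.
have aa : a = a `^ ((p - 1) / p) * a `^ p^-1.
  rewrite -powRD; last by rewrite (gt_eqF alpha_gt0) implybT.
  have -> : (p - 1) / p + p^-1 = 1 by field; rewrite gt_eqF.
  by rewrite powRr1// ltW.
have ap : 0 < a `^ ((p - 1) / p) by rewrite powR_gt0.
have h4 : gamma * (a * n * ell) * (sigma / a `^ p^-1) <= c * Delta.
  apply: (@le_trans _ _ (c * B4 * (a * n * ell) * (sigma / a `^ p^-1))).
    by rewrite ler_pM2r ?divr_gt0// ler_pM2r//; exact: gamma_le4.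
  rewrite le_eqVlt; apply/orP; left; apply/eqP.
  rewrite [X in _ * (X * n * ell)]aa.
  by field; rewrite !gt_eqF.
have h5 : gamma * lh * (n * ell) <= 2 * (c * Delta).
  have P5 : 0 < (L + sigma_h) * n * ell by rewrite !mulr_gt0.
  have DP : 0 <= Delta * a `^ p^-1 / ((L + sigma_h) * n * ell).
    by rewrite divr_ge0 ?mulr_ge0// ltW.
  have h : gamma ^+ 2 <= (c * B5) ^+ 2.
    rewrite ler_pXn2r ?nnegrE ?(ltW gamma0)//; first exact: gamma_le5.
    by rewrite mulr_ge0 ?sqrtr_ge0// ltW.
  have -> : gamma * lh * (n * ell) =
      2 * ((L + sigma_h) * n * ell / a `^ p^-1 * gamma ^+ 2).
    by field; rewrite gt_eqF.
  rewrite ler_pM2l//.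
  apply: (@le_trans _ _ ((L + sigma_h) * n * ell / a `^ p^-1 * (c * B5) ^+ 2)).
    by rewrite ler_pM2l// divr_gt0.
  rewrite exprMn (sqr_sqrtr DP).
  have -> : (L + sigma_h) * n * ell / a `^ p^-1 *
      (c ^+ 2 * (Delta * a `^ p^-1 / ((L + sigma_h) * n * ell))) = c * (c * Delta).
    by field; rewrite !gt_eqF.
  by rewrite ler_pM2l// ler_piMl ?(ltW D0)//; have := c_le; have := c0; lra.
have hl : gamma * (a * n * ell) * l <= 4 * (c * Delta).
  have ga : 0 <= gamma * (a * n * ell) by rewrite mulr_ge0// ltW.
  rewrite maxr_pMr// ge_max; apply/andP; split; last by lra.
  by rewrite mulrCA ler_pM2l.
have -> : gamma * (a * l + lh) * n * ell =
  gamma * (a * n * ell) * l + gamma * lh * (n * ell) by ring.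
by move: hl h5; move: (_ * l) (_ * (n * ell)) => X Y hl h5; lra.
Qed.

End levels.

Hypothesis ell_ge : 1 / 2 <= ell.
Local Notation s := (Num.sqrt (Delta * (L + sigma_h))).
Local Notation Q := (n `^ ((p - 1) / (2 * p - 1))).

Lemma s_gt0 : 0 < s. Proof. by rewrite sqrtr_gt0 mulr_gt0. Qed.
Local Hint Resolve s_gt0 : core.

Lemma Q_gt0 : 0 < Q. Proof. exact: powR_gt0. Qed.
Local Hint Resolve Q_gt0 : core.

Lemma r_le_s : r <= s.
Proof.
have h : L * Delta <= Delta * (L + sigma_h) by rewrite mulrC ler_pM2l// lerDl ltW.
by rewrite ler_wsqrtr.
Qed.

(** [r * n * B1] equals [Delta * sqrt n], and the exponent of [Q] is below 1/2. *)
Lemma rate_term1 : Delta * Q <= r * n * B1.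
Proof.
have DLn : 0 <= Delta / (L * n) by rewrite divr_ge0// ?mulr_ge0// ltW.
have LD : 0 <= L * Delta by rewrite mulr_ge0// ltW.
have -> : r * n * B1 = Delta * Num.sqrt n.
  have -> : r * n * B1 = n * Num.sqrt ((Delta / n) ^+ 2 * n).
    rewrite mulrAC -sqrtrM// mulrC; congr (_ * Num.sqrt _).
    by field; rewrite !gt_eqF.
  rewrite sqrtrM ?sqr_ge0// sqrtr_sqr ger0_norm ?divr_ge0 ?(ltW n_gt0) ?(ltW D0)//.
  by field; rewrite gt_eqF.
rewrite ler_pM2l// -powR12_sqrt ?(ltW n_gt0)// ler_powR//.
by rewrite ler_pdivrMr//; have := p1; lra.
Qed.

Lemma rate_term3 : Delta * Q <= s * Num.sqrt (Delta / L) * (2 / a).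
Proof.
have k1 : Delta <= s * Num.sqrt (Delta / L).
  by rewrite -{1}sqrt_mul_div mulrC ler_wpM2r ?sqrtr_ge0// r_le_s.
have k2 : Q <= 2 / a.
  have : Q <= a^-1.
    rewrite aE powRN invrK ler_powR// ler_pM2r ?invr_gt0//; have := p1; lra.
  have : 0 < a^-1 by rewrite invr_gt0.
  by lra.
by apply: ler_pM => //; exact: ltW.
Qed.

(** The choice of [a] gives [a^(1/p) * n = Q^2], so the square root in [B5] produces exactly [Q];
    the remaining [sqrt ell] is at least 1/2. *)
Lemma rate_term5 : Delta * Q <= 2 * (s * B5 * (n * ell)).
Proof.
have l0 := ell_gt0 ell_ge.
have apE : a `^ p^-1 * n = Q ^+ 2.
  rewrite aE -powRrM -[X in _ * X](powRr1 (ltW n_gt0)).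
  rewrite -powRD ?(gt_eqF n_gt0) ?implybT// expr2 -powRD ?(gt_eqF n_gt0) ?implybT//.
  by congr (_ `^ _); field; rewrite !gt_eqF.
have sB : s * B5 * (n * ell) = Delta * Q * Num.sqrt ell.
  have DL : 0 <= Delta * (L + sigma_h) by rewrite mulr_ge0// ltW.
  have nl : 0 < n * ell by rewrite mulr_gt0.
  have apE' : a `^ p^-1 = Q ^+ 2 / n by rewrite -apE mulfK// gt_eqF.
  rewrite -sqrtrM// apE'.
  have -> : Delta * (L + sigma_h) * (Delta * (Q ^+ 2 / n) / ((L + sigma_h) * n * ell)) =
      (Delta * Q / (n * ell)) ^+ 2 * ell.
    by field; rewrite !gt_eqF.
  rewrite sqrtrM ?sqr_ge0// sqrtr_sqr ger0_norm; last first.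
    by rewrite divr_ge0 ?mulr_ge0// ltW.
  by rewrite mulrAC divfK// gt_eqF.
rewrite sB; have k2 : 1 / 2 <= Num.sqrt ell.
  by rewrite -[leLHS]ger0_norm// -sqrtr_sqr ler_sqrt//; have := ell_ge; lra.
have DQ : 0 <= Delta * Q by rewrite mulr_ge0 ?ltW.
by have := ler_wpM2l DQ k2; lra.
Qed.

Lemma stepsize_rate (gamma : R) : gamma = c * bound -> 0 < gamma ->
  2 * Delta / (gamma * n) <= 4 / c * ((s + sigma) / Q * ell).
Proof.
move=> gE gamma0; have l0 := ell_gt0 ell_ge.
(* [Delta * Q / K] is a common lower bound of the five terms. The factor 2 offsets [ell >= 1 / 2] in
   those without a logarithm. *)
have [K KE] : exists K, K = 2 * (s + sigma) * ell * n by eexists.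
have ss : 0 < s + sigma by rewrite addr_gt0.
have K0 : 0 < K by rewrite KE !mulr_gt0.
have sK : s * n <= K.
  have h : s * n <= (s + sigma) * n by rewrite ler_pM2r// lerDl ltW.
  apply: le_trans h _; have -> : K = (s + sigma) * n * (2 * ell) by rewrite KE; ring.
  by rewrite ler_peMr ?mulr_ge0 ?(ltW ss) ?(ltW n_gt0)//; have := ell_ge; lra.
have rK : r * n <= K.
  by apply: le_trans sK; rewrite ler_pM2r// r_le_s.
have main : Delta * Q / K <= bound.
  rewrite !le_min !ler_pdivrMr// ![_ * K]mulrC.
  apply/and5P; split.
  - by apply: le_trans rate_term1 _; rewrite ler_wpM2r// sqrtr_ge0.
  - have B0 : 0 <= B2 by rewrite mulr_ge0 ?sqrtr_ge0// ltW.
    apply: (@le_trans _ _ (r * n * B2)); last by rewrite ler_wpM2r.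
    have -> : r * n * B2 = (Num.sqrt (Delta / L) * r) * (a * n) by ring.
    by rewrite sqrt_mul_div alphaM.
  - have -> : K * B3 = (s + sigma) * Num.sqrt (Delta / L) * (2 / a).
      by rewrite KE; field; rewrite !gt_eqF.
    apply: le_trans rate_term3 _; rewrite ler_pM2r ?divr_gt0//.
    by rewrite ler_wpM2r ?sqrtr_ge0// lerDl ltW.
  - have aQ : a `^ ((p - 1) / p) = Q^-1.
      rewrite aE -powRrM -powRN; congr (_ `^ _).
      by field; rewrite !gt_eqF.
    have -> : K * B4 = Delta * Q * (2 * (s + sigma) / sigma).
      by rewrite aQ KE; field; rewrite !gt_eqF.
    rewrite ler_peMr ?mulr_ge0 ?(ltW D0) ?(ltW Q_gt0)//.
    by rewrite ler_pdivlMr//; have := s_gt0; have := sigma0; lra.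
  - apply: le_trans rate_term5 _.
    have -> : K * B5 = 2 * (s * B5 * (n * ell)) + 2 * (sigma * B5 * (n * ell)).
      by rewrite KE; ring.
    by rewrite lerDl !mulr_ge0 ?sqrtr_ge0// ltW.
have k : Delta * Q / K <= gamma / c.
  by rewrite gE [c * _]mulrC mulfK ?gt_eqF.
rewrite ler_pdivrMr ?mulr_gt0//.
have -> : 4 / c * ((s + sigma) / Q * ell) * (gamma * n) = 2 * (gamma / c * K / Q).
  by rewrite KE; field; rewrite !gt_eqF.
rewrite ler_pM2l// ler_pdivlMr//.
by move: k; rewrite ler_pdivrMr.
Qed.

End stepsize.
End parameters.

(** * High-probability bound *)

Theorem theorem3 (R : realType) :
  exists c C : R, 0 < c /\ 0 < C /\
  forall (d : nat) (dO dX : measure_display)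
    (Omega : measurableType dO) (Xi : measurableType dX)
    (P : probability Omega R) (D : probability Xi R)
    (f : 'rV[R]_d -> Xi -> R) (F : 'rV[R]_d -> R)
    (Fstar L sigma sigma_h p delta : R) (T : nat)
    (x0 : 'rV[R]_d) (gamma : R)
    (q : nat -> {RV P >-> R}) (xi xihat : nat -> {RV P >-> Xi})
    (x g : nat -> Omega -> 'rV[R]_d),
  0 < L -> 0 < sigma -> 0 < sigma_h -> 1 < p -> p <= 2 ->
  oracle_regular D f ->
  objective D f F ->
  (forall y, Fstar <= F y) ->
  smooth L F ->
  (forall y, twice_differentiable_at F y) ->
  bcm_grad D f F p sigma ->
  bcm_hess D f F p sigma_h ->
  0 < delta -> delta <= 1 -> (1 <= T)%N -> 1 <= ln (8 * T%:R / delta) ->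
  let Delta1 := F x0 - Fstar in
  let alpha := T%:R `^ (- (p / (2 * p - 1))) in
  let lambda := Num.max (4 * Num.sqrt (L * Delta1)) (sigma / alpha `^ p^-1) in
  let lambda_h := 2 * gamma * (L + sigma_h) / alpha `^ p^-1 in
  let bound := stepsize_bound Delta1 L sigma sigma_h p alpha delta T in
  sampling D T q xi xihat ->
  clip_nsgd_hess f x0 gamma alpha lambda lambda_h T q xi xihat x g ->
  0 < gamma -> gamma <= c * bound ->
  ((1 - delta)%:E <=
     P [set w | (avg_grad_norm F T x w <= 2 * Delta1 / (gamma * T%:R))%R])%E /\
  (gamma = c * bound -> 2 <= T%:R / delta ->
   ((1 - delta)%:E <=
     P [set w | (avg_grad_norm F T x w <=
          C * ((Num.sqrt (Delta1 * (L + sigma_h)) + sigma)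
                 / T%:R `^ ((p - 1) / (2 * p - 1)) * ln (T%:R / delta)))%R])%E).
Proof.
have [c [c0 c_le]] : exists c : R, 0 < c /\ 200 * (200 * c) <= 1.
  (* Any [c] this small meets the demand of [budget_arith], with room to spare. *)
  by exists (200 * 200)^-1; split; [rewrite invr_gt0 mulr_gt0|rewrite mulrA mulfV// mulf_neq0].
exists c, (4 / c); split => //; split; first by rewrite divr_gt0.
move=> d dO dX Omega Xi P D f F Fstar L sigma sigma_h p delta T x0 gamma q xi xihat x g.
move=> L0 sigma0 sigma_h0 p1 p2 rf _ F_ge sF F2 bG bH delta0 delta1 T0 _.
move=> Delta a l lh bound samp alg gamma0 gle.
have n1 : 1 <= T%:R :> R by rewrite ler1n.
have n0 : 0 < T%:R :> R by rewrite ltr0n.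
have aE : a = T%:R `^ (- (p / (2 * p - 1))) by [].
have p12 : 1 < p <= 2 by rewrite p1.
have a0 : 0 < a by exact: alpha_gt0 n1 aE.
(* With [Delta = 0] the stepsize bound would be 0, against [0 < gamma]. *)
have Delta0 : 0 < Delta.
  rewrite lt_def subr_ge0 F_ge andbT; apply/eqP => D0.
  have := lt_le_trans gamma0 (gamma_le2 c0 gle).
  by rewrite D0 mul0r sqrtr0 !mulr0 ltxx.
have a1 : a <= 1 by exact: alpha_le1 p1 n1 aE.
have an : 1 <= a * T%:R by exact: alphaM_ge1 p1 n1 aE.
have N2 := smooth_grad_sqr sF x0 L0 F_ge.
have hN := stepsize_grad c0 L0 Delta0 gamma0 gle (l2norm_ge0 _) N2.
have l0 : 0 < l by exact: level_gt0.
have lh0 : 0 < lh by exact: level_h_gt0 n1 aE _ gamma0.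
have m0 : 0 < a * l + lh by rewrite addr_gt0// mulr_gt0.
have a01 : 0 < a <= 1 by rewrite a0.
have first_le : gamma * l2norm (grad F x0) <= Delta / 10.
  apply: (le_trans hN).
  have cD : 200 * (200 * c) * Delta <= 1 * Delta by rewrite ler_pM2r.
  have acD : a * (c * Delta) <= 1 * (c * Delta) by rewrite ler_pM2r// mulr_gt0.
  by lra.
have lam_ge : 4 * Num.sqrt (L * (F x0 - Fstar)) <= l by rewrite le_max lexx.
have dF2 y : differentiable (grad F) y by case: (F2 y).
have mavg b := measurable_avg_grad_norm rf dF2 alg b T0.
have avg_le w z : (avg_grad_norm F T x w <= z / (gamma * T%:R)) =
    (gamma * \sum_(0 <= t < T) l2norm (grad F (x t w)) <= z).
  rewrite /avg_grad_norm invfM mulrA [z / gamma / _]mulrC ler_pM2l ?invr_gt0//.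
  by rewrite ler_pdivlMr// mulrC.
have EP : ((1 - delta)%:E <=
    P [set w | (avg_grad_norm F T x w <= 2 * Delta / (gamma * T%:R))%R])%E.
  (* For [T = 1] the logarithm may be 0, but the average is the single deterministic gradient at
     [x0]. From [T = 2] on, [ln (T / delta) >= 1 / 2]. *)
  have [T1|T2] := leqP T 1.
    have ET : T = 1%N by apply/eqP; rewrite eqn_leq T1.
    have -> : [set w | avg_grad_norm F T x w <= 2 * Delta / (gamma * T%:R)] = setT.
      apply/seteqP; split => w // _ /=; rewrite avg_le ET big_nat1 (cnh_x0 alg).
      by apply: le_trans first_le _; lra.
    by rewrite probability_setT lee_fin lerBlDr lerDl ltW.
  have Td : T%:R <= T%:R / delta by rewrite ler_peMr ?invf_ge1 ?(ltW n0).
  have ell_ge : 1 / 2 <= ln (T%:R / delta).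
    by apply: ln_ge_half; apply: le_trans Td; rewrite ler_nat.
  have deltaV0 : 0 < delta^-1 by rewrite invr_gt0.
  have b_le : ln delta^-1 <= ln (T%:R / delta).
    by rewrite ler_ln ?posrE ?divr_gt0// ler_peMl ?(ltW deltaV0).
  have budget := budget_arith c0 c_le gamma0 a0 (ltW m0) (ltW Delta0) an ell_ge b_le
    (stepsize_level c0 c_le L0 sigma0 sigma_h0 p1 Delta0 n1 aE gamma0 gle ell_ge) hN
    (stepsize_smooth c0 c_le L0 Delta0 n1 gamma0 gle).
  have [mA PA] := stopped_exp_tail L0 sigma0 sigma_h0 p12 rf sF dF2 bG bH gamma0 a01
    l0 lh0 erefl (level_grad L0 sigma0 p1 Delta0 n1 aE)
    (level_hess L0 sigma_h0 p1 n1 aE gamma0) (level_smooth L0 sigma_h0 p1 n1 aE gamma0)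
    (level_lipschitz L0 sigma_h0 p1 n1 aE gamma0) samp alg F_ge lam_ge delta0 T0.
  apply: (le_trans PA); apply: le_measure; rewrite ?inE// => w /= Ww.
  rewrite avg_le /Delta -(cnh_x0 alg w).
  apply: (sum_grad_le sF (ltW L0) gamma0 _ _ _ F_ge m0 a01 (gs := g^~ w) (b := ln delta^-1)) => //.
  - by rewrite (cnh_x1 alg) (cnh_x0 alg).
  - exact: (cnh_g0 alg).
  - by move=> t tT; exact: (cnh_xS alg).
  - by rewrite (cnh_x0 alg).
  - by rewrite (cnh_x0 alg).
  - by rewrite lnK ?posrE.
split => // gE T2; apply: (le_trans EP); apply: le_measure; rewrite ?inE// => w /=.
move=> /le_trans; apply.
exact: (stepsize_rate c0 L0 sigma0 sigma_h0 p1 Delta0 n1 aE (ln_ge_half T2) gE gamma0).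
Qed.
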